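(* Let $n$ be an integer and let $T_{2n}$ be the two-bridge knot with Conway's notation $C(2n,3)$. Then the $A$-polynomial $A_{2n}=A_{2n}(L,M)$ of $T_{2n}$ is given explicitly by \[ A_{2n}=\sum_{i=0}^{2n}\binom{n+\lfloor i/2\rfloor}{i}\left(\frac{(LM^{4n}-1)(1-M^{2})}{1+LM^{2+4n}}\right)^{i}\left(\frac{1+LM^{6+4n}}{M^{2}+LM^{4+4n}}\right)^{\lfloor (1+i)/2\rfloor} M^{-2n}\left(1+LM^{2+4n}\right)^{3n} \] if $n\ge 0$, and \[ A_{2n}=\sum_{i=0}^{-2n-1}\binom{-n+\lfloor (i-1)/2\rfloor}{i}\left(\frac{(1-M^{2})(M^{-4n}-L)}{LM^{2}+M^{-4n}}\right)^{i}\left(\frac{LM^{6}+M^{-4n}}{LM^{4}+M^{2-4n}}\right)^{\lfloor (1+i)/2\rfloor} M^{8n+6}\left(LM^{2}+M^{-4n}\right)^{-3n-1} \] if $n<0$.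
   Context: The knot $T_{2n}$ with Conway's notation $C(2n,3)$ is the two-bridge knot whose diagram consists of a twist region with $2n$ half-twists followed by a twist region with $3$ half-twists (for $n<0$ the first twist region has $|2n|$ half-twists of the opposite sense); it is the mirror image of the double twist knot $J[3,-2n]$. Its exterior $X_{2n}$ has fundamental group $\langle s,t\mid swt^{-1}w^{-1}=1\rangle$ with $w=(ts^{-1}tst^{-1}s)^n$, where $s,t$ are meridians, and $l=ww^{*}s^{-4n}$ (with $w^*$ the word $w$ written in reverse) is the null-homologous longitude. The $A$-polynomial $A(L,M)$ (Cooper–Culler–Gillet–Long–Shalen) of a knot exterior is the polynomial defining the closure of the set of pairs $(L,M)\in(\mathbb{C}^* )^2$ such that there is a nonabelian representation $\rho:\pi_1(X_{2n})\to \mathrm{SL}(2,\mathbb{C})$ with $\rho(s)$, $\rho(l)$ upper triangular having upper-left entries $M$ and $L$ respectively (eigenvalues of meridian and longitude); it is defined up to multiplication by a nonzero constant, and the formula above gives the normalized representative (a polynomial with no monomial factor). Here $\binom{a}{b}$ denotes the usual binomial coefficient and $\lfloor\cdot\rfloor$ the floor function. *)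

(* Defs.v *)
From HB Require Import structures.
From mathcomp Require Import all_boot all_order all_algebra.
From mathcomp Require Import complex.
From mathcomp Require Import Rstruct.
From Stdlib Require Rdefinitions.
Set Implicit Arguments. Unset Strict Implicit. Unset Printing Implicit Defensive.
Import Order.TTheory GRing.Theory Num.Theory.
Local Open Scope ring_scope.

Definition CC : numClosedFieldType := (Rdefinitions.R)[i].

(* a letter is (g, e): g = true for s, false for t; e = true for an inverse *)
Definition letter := (bool * bool)%type.
Definition word := seq letter.

Definition ls : letter := (true, false).
Definition lsi : letter := (true, true).
Definition lt : letter := (false, false).
Definition lti : letter := (false, true).

Definition inv_word (u : word) : word := rev [seq (x.1, ~~ x.2) | x <- u].

Definition u_word : word := [:: lt; lsi; lt; ls; lti; ls].

Definition word_pow (u : word) (n : int) : word :=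
  match n with
  | Posz k => flatten (nseq k u)
  | Negz k => flatten (nseq k.+1 (inv_word u))
  end.

Definition w_word (n : int) : word := word_pow u_word n.

Definition wstar_word (n : int) : word := rev (w_word n).

Definition relator (n : int) : word :=
  [:: ls] ++ w_word n ++ [:: lti] ++ inv_word (w_word n).

Definition longitude (n : int) : word :=
  w_word n ++ wstar_word n ++ word_pow [:: ls] (- (4 * n)).

Definition mat := 'M[CC]_2.

Definition eval_letter (S T : mat) (x : letter) : mat :=
  let A := if x.1 then S else T in if x.2 then invmx A else A.

Definition eval_word (S T : mat) (u : word) : mat :=
  foldr (fun x acc => eval_letter S T x *m acc) 1%:M u.

(* A representation rho : pi_1(X_{2n}) -> SL(2,C) is given by the images
   S = rho(s), T = rho(t), which must lie in SL(2,C) and satisfy the relator. *)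
Definition is_SL2_rep (n : int) (S T : mat) : Prop :=
  \det S = 1 /\ \det T = 1 /\ eval_word S T (relator n) = 1%:M.

Definition nonabelian (S T : mat) : Prop := S *m T <> T *m S.

Definition upper_triangular (A : mat) : Prop := A 1 0 = 0.

Definition eigen_set (n : int) (L M : CC) : Prop :=
  L != 0 /\ M != 0 /\
  exists S T : mat,
    is_SL2_rep n S T /\ nonabelian S T /\
    upper_triangular S /\ upper_triangular (eval_word S T (longitude n)) /\
    S 0 0 = M /\ (eval_word S T (longitude n)) 0 0 = L.

(* P : {poly {poly CC}}: the outer variable is L, the inner variable is M. *)
Definition ev2 (P : {poly {poly CC}}) (L M : CC) : CC := (P.[M%:P]).[L].

Definition varL : {poly {poly CC}} := 'X.
Definition varM : {poly {poly CC}} := ('X)%:P.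

Definition zariski_closure (X : CC -> CC -> Prop) (L M : CC) : Prop :=
  L != 0 /\ M != 0 /\
  forall f : {poly {poly CC}}, (forall L' M', X L' M' -> ev2 f L' M' = 0) ->
    ev2 f L M = 0.

Definition squarefree2 (P : {poly {poly CC}}) : Prop :=
  forall Q R : {poly {poly CC}}, P = Q * Q * R -> Q \is a GRing.unit.

Definition no_monomial_factor (P : {poly {poly CC}}) : Prop :=
  (forall R, P <> varL * R) /\ (forall R, P <> varM * R).

(* P is (a normalized representative of) the A-polynomial of X_{2n}:
   P is a nonzero reduced polynomial without monomial factors whose zero
   locus in (C\{0})^2 is the union of the one-dimensional components of the
   Zariski closure of the eigenvalue set, i.e. that closure is the zero set
   of P in the torus together with finitely many (isolated) points. *)
Definition is_A_polynomial (n : int) (P : {poly {poly CC}}) : Prop :=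
  P != 0 /\ squarefree2 P /\ no_monomial_factor P /\
  exists F : seq (CC * CC),
    forall L M, zariski_closure (eigen_set n) L M <->
      ((L != 0 /\ M != 0 /\ ev2 P L M = 0) \/ (L, M) \in F).

(* floor (a / 2) for an integer a (intdiv's division by 2 is the floor) *)
Definition floor2 (a : int) : int := (a %/ 2)%Z.

(* binomial coefficient with an integer (here always nonnegative) top *)
Definition binz (a : int) (b : nat) : nat := 'C(absz a, b).

Definition A_formula_nonneg (n : int) (L M : CC) : CC :=
  \sum_(i < (absz (2 * n)).+1)
     (binz (n + floor2 i%:Z) i)%:R
     * (((L * M ^ (4 * n) - 1) * (1 - M ^+ 2)) / (1 + L * M ^ (2 + 4 * n))) ^+ i
     * ((1 + L * M ^ (6 + 4 * n)) / (M ^+ 2 + L * M ^ (4 + 4 * n)))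
         ^ (floor2 (1 + i%:Z))
     * M ^ (- (2 * n)) * (1 + L * M ^ (2 + 4 * n)) ^ (3 * n).

Definition A_formula_neg (n : int) (L M : CC) : CC :=
  \sum_(i < (absz (2 * n)))
     (binz (- n + floor2 (i%:Z - 1)) i)%:R
     * (((1 - M ^+ 2) * (M ^ (- (4 * n)) - L)) / (L * M ^+ 2 + M ^ (- (4 * n)))) ^+ i
     * ((L * M ^+ 6 + M ^ (- (4 * n))) / (L * M ^+ 4 + M ^ (2 - 4 * n)))
         ^ (floor2 (1 + i%:Z))
     * M ^ (8 * n + 6) * (L * M ^+ 2 + M ^ (- (4 * n))) ^ (- (3 * n) - 1).

Definition formula_defined (n : int) (L M : CC) : Prop :=
  L != 0 /\ M != 0 /\
  if (0 <= n)%R then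
    1 + L * M ^ (2 + 4 * n) != 0 /\ M ^+ 2 + L * M ^ (4 + 4 * n) != 0
  else
    L * M ^+ 2 + M ^ (- (4 * n)) != 0 /\ L * M ^+ 4 + M ^ (2 - 4 * n) != 0.

Definition A_formula (n : int) (L M : CC) : CC :=
  if (0 <= n)%R then A_formula_nonneg n L M else A_formula_neg n L M.

(* Main.v *)
Require Import Defs.
From HB Require Import structures.
From mathcomp Require Import all_boot all_order all_algebra.
From mathcomp Require Import complex.
From mathcomp Require Import polyXY ring zify.
Set Implicit Arguments. Unset Strict Implicit. Unset Printing Implicit Defensive.
Import Order.TTheory GRing.Theory Num.Theory.
Local Open Scope ring_scope.

(* Put P = rho(s)^-1, Q = rho(t)^-1, x = M + 1/M, and take X = x^2 - 1 - tr(PQ)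
   as coordinate on the characters.  With Y = x^2 - 3 - X, the trace of
   u = ts^-1tst^-1s is X^2 Y + 2, and u^n = e + o (1 - u^-1) for Chebyshev-like
   polynomials e, o in X^2 Y.  Then sw - wt = (e + o X Y)(s - t), so the Riley
   polynomial is phi = e + o X Y, whose binomial expansion is the sum in the
   formula; and ww* turns out to be a combination of 1 and P, whose eigenvalue
   l = L M^(4n) satisfies X (1 + l M^2) = (l - 1)(1 - M^2).  Hence X and Y are
   Moebius functions of l, and clearing denominators in phi(X, Y) = 0 yields Phi,
   homogeneous in A = 1 + l M^2, B = (l - 1)(1 - M^2), C = 1 + l M^6.
   Phi is reduced because at M^2 = -1, after blowing up the point l = 1, it
   becomes (1 + q^(2D+1))/(1 + q) in an eigenvalue q of a rotation of a dihedral
   representation; a resultant carries separability over to generic M.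
   The leading coefficient in L vanishes only at M = 0, so a polynomial vanishing
   on the generic part of the curve vanishes on all of it. *)

(** * The recursion and the homogeneous polynomial Phi *)

(** One step is a linear map of the pair with trace a + 2b and determinant b^2. At b = 1 it has the
    characteristic polynomial of u for a = tr u - 2; general b is the homogenized version. *)
Fixpoint cheb (R : comNzRingType) (a b : R) (n : nat) : R * R :=
  if n is m.+1 then
    let o := b * (cheb a b m).2 + (cheb a b m).1 in
    (b * (cheb a b m).1 + a * o, o)
  else (1, 0).

Definition chebE (R : comNzRingType) (a b : R) n := (cheb a b n).1.
Definition chebO (R : comNzRingType) (a b : R) n := (cheb a b n).2.

(** The total degree of [Phi] in A, B, C, and the exponent of the last factor in the formula. *)
Definition hdeg (n : int) : nat :=
  match n with Posz k => 3 * k | Negz k => 3 * k + 2 end.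

Definition Phi (R : comNzRingType) (n : int) (A B C x : R) : R :=
  let a := B ^+ 2 * C in
  let b := x * A ^+ 3 in
  match n with
  | Posz k => chebE a b k + B * C * A * chebO a b k
  | Negz k => x * A ^+ 2 * chebE a b k - B * C * chebO a b k.+1
  end.

Section ChebAlgebra.
Variable R : comNzRingType.
Implicit Types (a b c x A B C : R) (k : nat) (n : int).

Lemma chebE0 a b : chebE a b 0 = 1. Proof. by []. Qed.
Lemma chebO0 a b : chebO a b 0 = 0. Proof. by []. Qed.
Lemma chebOS a b k : chebO a b k.+1 = b * chebO a b k + chebE a b k.
Proof. by []. Qed.
Lemma chebES a b k : chebE a b k.+1 = b * chebE a b k + a * chebO a b k.+1.
Proof. by []. Qed.

Lemma cheb_scale c a b k :
  chebE (c * a) (c * b) k = c ^+ k * chebE a b k /\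
  chebO (c * a) (c * b) k.+1 = c ^+ k * chebO a b k.+1.
Proof.
elim: k => [|k [IHE IHO]]; first by rewrite !chebOS !chebE0 !chebO0 !expr0; split; ring.
have E : chebE (c * a) (c * b) k.+1 = c ^+ k.+1 * chebE a b k.+1.
  by rewrite (chebES a) chebES IHE IHO exprS; ring.
by split=> //; rewrite chebOS E IHO (chebOS a b k.+1) exprS; ring.
Qed.

Lemma chebE_scale c a b k : chebE (c * a) (c * b) k = c ^+ k * chebE a b k.
Proof. by case: (cheb_scale c a b k). Qed.

Lemma chebO_scale c a b k :
  chebO (c * a) (c * b) k.+1 = c ^+ k * chebO a b k.+1.
Proof. by case: (cheb_scale c a b k). Qed.

Lemma cheb_a0 a k : chebE a 0 k = a ^+ k /\ chebO a 0 k.+1 = a ^+ k.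
Proof.
elim: k => [|k [IHE IHO]]; first by rewrite chebOS chebE0 chebO0 expr0; split; ring.
have E : chebE a 0 k.+1 = a ^+ k.+1 by rewrite chebES IHO exprS; ring.
by split=> //; rewrite chebOS E; ring.
Qed.

(** For a = (1 - x)^2 and b = x the step of the recursion has eigenvalues x^2 and 1. The combination
    here is the left eigenvector for x^2, the one in [chebE_sq1] that for 1. *)
Lemma chebE_sq x k :
  chebE ((1 - x) ^+ 2) x k - (1 - x) * chebO ((1 - x) ^+ 2) x k = x ^+ (2 * k).
Proof.
elim: k => [|k IH]; first by rewrite chebE0 chebO0 muln0 expr0; ring.
by rewrite mulnS exprD -IH chebES chebOS; ring.
Qed.

Lemma chebE_sq1 x k :
  chebE ((1 - x) ^+ 2) x k + x * (1 - x) * chebO ((1 - x) ^+ 2) x k = 1.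
Proof.
elim: k => [|k IH]; first by rewrite chebE0 chebO0; ring.
by rewrite -[RHS]IH chebES chebOS; ring.
Qed.

(** For a = -4 and b = 1 the step has the double eigenvalue -1, and this is its left eigenvector. *)
Lemma cheb_m4 k : chebE (- 4%:R : R) 1 k + 2 * chebO (- 4%:R : R) 1 k = (-1) ^+ k.
Proof.
elim: k => [|k IH]; first by rewrite chebE0 chebO0 expr0; ring.
by rewrite exprS -IH chebES chebOS; ring.
Qed.

Lemma Phi_scale n c A B C x :
  Phi n (c * A) (c * B) (c * C) x = c ^+ hdeg n * Phi n A B C x.
Proof.
have ea : (c * B) ^+ 2 * (c * C) = c ^+ 3 * (B ^+ 2 * C) by ring.
have eb : x * (c * A) ^+ 3 = c ^+ 3 * (x * A ^+ 3) by ring.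
case: n => [[|k]|k]; rewrite /Phi ea eb.
- by rewrite /= !chebE0 !chebO0; ring.
- by rewrite /= chebE_scale chebO_scale -!exprM mulnS exprD; ring.
- by rewrite /= chebE_scale chebO_scale -!exprM exprD; ring.
Qed.

(** The arguments are A, B, C at l = 0. The value shows that the curve misses L = 0 and supplies the
    constant term in l. *)
Lemma Phi_at_l0 n x :
  Phi n 1 (- (1 - x)) 1 x = if n is Posz k then x ^+ (2 * k) else 1.
Proof.
have ea : (- (1 - x)) ^+ 2 * 1 = (1 - x) ^+ 2 by ring.
have eb : x * 1 ^+ 3 = x by ring.
case: n => k; rewrite /Phi ea eb; first by rewrite -chebE_sq; ring.
by rewrite -[RHS](chebE_sq1 x k) chebOS; ring.
Qed.

(** The arguments are the coefficients of l in A, B, C, so by homogeneity this is the leading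
    coefficient of [Phi] in l. Being a power of x, it vanishes only at M = 0. *)
Lemma Phi_lead n x :
  Phi n x (1 - x) (x ^+ 3) x =
  if n is Posz k then x ^+ (3 * k) else x ^+ (5 * `|n| - 1).
Proof.
have ea : (1 - x) ^+ 2 * x ^+ 3 = x ^+ 3 * (1 - x) ^+ 2 by ring.
have eb : x * x ^+ 3 = x ^+ 3 * x by ring.
case: n => [[|k]|k]; rewrite /Phi ea eb.
- by rewrite /= !chebE0 !chebO0; ring.
- rewrite /= chebE_scale chebO_scale -!exprM.
  by rewrite -[RHS]mulr1 -[X in _ = _ * X](chebE_sq1 x k.+1) mulnS exprD; ring.
- rewrite chebE_scale chebO_scale -!exprM NegzE abszN /=.
  have -> : (5 * k.+1 - 1 = 3 * k + 4 + 2 * k)%N by rewrite mulnS addSn subn1 /= -addnA [in RHS]addnC -addnA -mulnDl.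
  by rewrite 2!exprD -chebE_sq chebOS; ring.
Qed.

Lemma Phi_m1_lead n : Phi n (-1) 2 (-1) (-1 : R) =
  (-1) ^+ (if n is Posz k then k else `|n|.-1).
Proof.
have ea : 2 ^+ 2 * (-1) = - 4%:R :> R by ring.
have eb : (-1) * (-1) ^+ 3 = 1 :> R by ring.
case: n => k; rewrite /Phi ea eb /=.
  by rewrite -cheb_m4; ring.
by rewrite -cheb_m4 chebOS; ring.
Qed.

(* With c = q^3 the arguments become ((1 - c)^2, c), where both eigenvectors of
   the recursion are explicit; q is the eigenvalue of a rotation in a dihedral
   representation. *)
Lemma Phi_dihedral n (q : R) :
  (1 - q + q ^+ 2) * ((1 + q) * Phi n (- q) (q ^+ 2 + q + 1) ((q - 1) ^+ 2) (-1)) =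
  (1 - q + q ^+ 2) * ((if n is Posz _ then 1 else -1) * (1 + q ^+ (2 * hdeg n + 1))).
Proof.
set c := q ^+ 3.
have ea : (q ^+ 2 + q + 1) ^+ 2 * ((q - 1) ^+ 2) = (1 - c) ^+ 2 by rewrite /c; ring.
have eb : (-1) * (- q) ^+ 3 = c by rewrite /c; ring.
case: n => k; rewrite /Phi ea eb /hdeg.
  set E := chebE _ _ _; set O := chebO _ _ _.
  have h1 := chebE_sq c k; have h2 := chebE_sq1 c k; rewrite -/E -/O in h1 h2.
  have -> : (2 * (3 * k) + 1 = 3 * (2 * k) + 1)%N by rewrite mulnCA.
  rewrite exprD (exprM q 3) -/c -h1.
  transitivity ((1 - q + q ^+ 2) * (E + c * (1 - c) * O + q * (E - (1 - c) * O))).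
    by rewrite /c; ring.
  by rewrite h2; ring.
rewrite chebOS; set E := chebE _ _ _; set O := chebO _ _ _.
have h1 := chebE_sq c k; have h2 := chebE_sq1 c k; rewrite -/E -/O in h1 h2.
have -> : (2 * (3 * k + 2) + 1 = 3 * (2 * k) + 5)%N by rewrite mulnDr mulnCA -addnA.
rewrite exprD (exprM q 3) -/c -h1.
transitivity (- (1 - q + q ^+ 2) * (E + c * (1 - c) * O + q ^+ 5 * (E - (1 - c) * O))).
  by rewrite /c; ring.
by rewrite h2; ring.
Qed.

End ChebAlgebra.

Lemma cheb_rmorph (R S : comNzRingType) (f : {rmorphism R -> S}) (a b : R) k :
  f (chebE a b k) = chebE (f a) (f b) k /\ f (chebO a b k) = chebO (f a) (f b) k.
Proof.
elim: k => [|k [IHE IHO]]; first by rewrite !chebE0 !chebO0 rmorph1 rmorph0.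
by rewrite !chebES !chebOS !(rmorphD, rmorphM) IHE IHO.
Qed.

Lemma Phi_rmorph (R S : comNzRingType) (f : {rmorphism R -> S}) n (A B C x : R) :
  f (Phi n A B C x) = Phi n (f A) (f B) (f C) (f x).
Proof.
by case: n => k; rewrite /Phi ?rmorphB ?rmorphD !rmorphM ?rmorphXn
  !(cheb_rmorph f _ _ _).1 !(cheb_rmorph f _ _ _).2 !(rmorphM, rmorphXn).
Qed.

(** * The binomial sums *)

(** The Riley polynomial e + o X Y. Running the recursion backwards at b = 1 gives the pair (E_k, -
    O_(k+1)) at index -(k + 1), whence the second case. *)
Definition phi (R : comNzRingType) (n : int) (X Y : R) : R :=
  let z := X ^+ 2 * Y in
  match n with
  | Posz k => chebE z 1 k + X * Y * chebO z 1 k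
  | Negz k => chebE z 1 k - X * Y * chebO z 1 k.+1
  end.

Lemma Phi_phi (R : comNzRingType) n (X Y x : R) :
  Phi n 1 X (x * Y) x = x ^+ `|n|%N * phi n X Y.
Proof.
have ea : X ^+ 2 * (x * Y) = x * (X ^+ 2 * Y) by ring.
have eb : x * 1 ^+ 3 = x * 1 by ring.
case: n => [[|k]|k]; rewrite /Phi /phi ea eb.
- by rewrite !chebE0 !chebO0 absz_nat expr0; ring.
- by rewrite chebE_scale chebO_scale absz_nat (exprS x k); ring.
- by rewrite chebE_scale chebO_scale NegzE abszN absz_nat (exprS x k); ring.
Qed.

(** At b = 1 both recursion steps are Pascal's rule; a vanishing top term is added to one sum so
    that the index ranges agree. *)
Lemma cheb_sum (R : comNzRingType) (a : R) k :
  chebE a 1 k = \sum_(j < k.+1) 'C(k + j, 2 * j)%:R * a ^+ j /\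
  chebO a 1 k = \sum_(j < k) 'C(k + j, 2 * j + 1)%:R * a ^+ j.
Proof.
elim: k => [|k [IHE IHO]].
  by rewrite big_ord_recl !big_ord0 chebE0 chebO0 bin0 expr0; split; ring.
have O : chebO a 1 k.+1 = \sum_(j < k.+1) 'C(k.+1 + j, 2 * j + 1)%:R * a ^+ j.
  rewrite chebOS IHO IHE mul1r.
  have -> : \sum_(j < k) 'C(k + j, 2 * j + 1)%:R * a ^+ j =
            \sum_(j < k.+1) 'C(k + j, 2 * j + 1)%:R * a ^+ j.
    rewrite big_ord_recr /= bin_small ?mul0r ?addr0 //.
    by rewrite addn1 mul2n addnn.
  rewrite -big_split; apply: eq_bigr => j _ /=.
  by rewrite addn1 addSn binS natrD mulrDl.
split=> //; rewrite chebES O IHE mul1r [in RHS]big_ord_recl /= muln0 bin0 expr0.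
rewrite big_ord_recl /= muln0 bin0 expr0 -addrA; congr (_ + _).
have -> : \sum_(i < k) 'C(k + bump 0 i, 2 * bump 0 i)%:R * a ^+ bump 0 i =
          \sum_(i < k.+1) 'C(k + bump 0 i, 2 * bump 0 i)%:R * a ^+ bump 0 i.
  rewrite [RHS]big_ord_recr /= [X in 'C(X, _)](_ : _ = (k + k).+1) ?bin_small ?mul0r ?addr0 //.
    by rewrite /bump /= add1n mulnS mul2n addnn addSn.
  by rewrite /bump /= add1n addnS.
rewrite mulr_sumr -big_split; apply: eq_bigr => j _ /=.
rewrite /bump /= add1n mulnS !addSn add0n addnS addn1 [in RHS]binS natrD (exprS a j).
by ring.
Qed.

Lemma big_ord_double (R : comNzRingType) (f : nat -> R) k :
  \sum_(i < 2 * k) f i = \sum_(j < k) f (2 * j)%N + \sum_(j < k) f (2 * j + 1)%N.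
Proof.
elim: k => [|k IH]; first by rewrite muln0 !big_ord0 addr0.
by rewrite mulnS !big_ord_recr /= IH addn1; ring.
Qed.

Lemma floor2_even j : floor2 (2 * j)%N = j%:Z.
Proof. by rewrite /floor2 divz_nat mulKn. Qed.

Lemma floor2_odd j : floor2 (2 * j + 1)%N = j%:Z.
Proof. by rewrite /floor2 divz_nat mulnC divnMDl // addn0. Qed.

(** Put z = X^2 Y. The terms with i = 2j carry z^j and those with i = 2j + 1 carry X Y z^j, so
    splitting by parity gives the sums of [cheb_sum]. *)
Lemma sum_formula_nonneg (X Y : CC) (k : nat) :
  \sum_(i < (2 * k).+1) (binz (k%:Z + floor2 i%:Z) i)%:R * X ^+ i *
     Y ^ (floor2 (1 + i%:Z)) = phi k X Y.
Proof.
rewrite big_ord_recr /=.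
rewrite (big_ord_double (fun i => (binz (k%:Z + floor2 i%:Z) i)%:R * X ^+ i *
     Y ^ (floor2 (1 + i%:Z)))).
rewrite addrAC.
rewrite /phi (cheb_sum _ _).1 (cheb_sum _ _).2 mulr_sumr.
transitivity (\sum_(i < k.+1) (binz (k%:Z + floor2 (2 * i)%N) (2 * i))%:R
  * X ^+ (2 * i) * Y ^ (floor2 (1 + (2 * i)%N%:Z)) +
  \sum_(j < k) (binz (k%:Z + floor2 (2 * j + 1)%N) (2 * j + 1))%:R
  * X ^+ (2 * j + 1) * Y ^ (floor2 (1 + (2 * j + 1)%N%:Z))).
  by rewrite big_ord_recr.
apply: congr2; apply: eq_bigr => j _.
  rewrite -intS -[(2 * j).+1]addn1 floor2_odd floor2_even /binz -PoszD absz_nat.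
  by rewrite exprMn -exprM mulrA.
rewrite -intS -[(2 * j + 1).+1]addn1 -addnA -(mulnDr 2 j 1) floor2_odd floor2_even.
rewrite /binz -PoszD absz_nat exprMn -exprM -exprnP (exprD Y) expr1 addn1 (exprS X).
by ring.
Qed.

(** The sign of X is reversed because the formula for n < 0 has M^(-4n) - L where the other one has
    L M^(4n) - 1. *)
Lemma sum_formula_neg (X Y : CC) (k : nat) :
  \sum_(i < 2 * k.+1) (binz (- (Negz k) + floor2 (i%:Z - 1)) i)%:R * X ^+ i *
     Y ^ (floor2 (1 + i%:Z)) = phi (Negz k) (- X) Y.
Proof.
rewrite (big_ord_double (fun i => (binz (- Negz k + floor2 (i%:Z - 1)) i)%:R * X ^+ i *
     Y ^ (floor2 (1 + i%:Z)))).
rewrite /phi (cheb_sum _ _).1 (cheb_sum _ _).2 mulr_sumr -sumrN.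
apply: congr2; apply: eq_bigr => j _.
  have -> : floor2 ((2 * j)%N%:Z - 1) = j%:Z - 1.
    have -> : (2 * j)%N%:Z - 1 = (j%:Z - 1) * 2%:Z + 1%N%:Z by rewrite PoszM; ring.
    by rewrite /floor2 divzMDl // divz_nat addr0.
  rewrite -intS -[(2 * j).+1]addn1 floor2_odd NegzE opprK.
  have -> : k.+1%:Z + (j%:Z - 1) = (k + j)%N by rewrite intS PoszD; ring.
  by rewrite /binz absz_nat sqrrN exprMn -exprM mulrA.
have -> : (2 * j + 1)%N%:Z - 1 = (2 * j)%N by rewrite PoszD; ring.
rewrite -intS -[(2 * j + 1).+1]addn1 -addnA -(mulnDr 2 j 1) floor2_even.
rewrite floor2_even NegzE opprK /binz -PoszD absz_nat sqrrN exprMn -exprM -exprnP.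
by rewrite (exprD Y) expr1 addn1 (exprS X); ring.
Qed.

Lemma Phi_param n (l M : CC) : M != 0 -> 1 + l * M ^+ 2 != 0 ->
  let A := 1 + l * M ^+ 2 in
  let X := (l - 1) * (1 - M ^+ 2) / A in
  let Y := (1 + l * M ^+ 6) / (M ^+ 2 * A) in
  Phi n A ((l - 1) * (1 - M ^+ 2)) (1 + l * M ^+ 6) (M ^+ 2) =
  A ^+ hdeg n * ((M ^+ 2) ^+ `|n|%N * phi n X Y).
Proof.
move=> M0 A0 A X Y; rewrite -Phi_phi -Phi_scale mulr1.
by congr (Phi n _ _ _ _); rewrite /X /Y; field; rewrite ?M0 ?A0.
Qed.

(* M ^ shift_exp n * Phi is a polynomial without monomial factor. *)
Definition shift_exp (n : int) : int :=
  match n with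
  | Posz k => - (4 * k%:Z)
  | Negz k => 12 * (k.+1%:Z * k.+1%:Z) - 14 * k.+1%:Z + 6
  end.

Definition PhiLM (F : fieldType) n (L M : F) : F :=
  let l := L * M ^ (4 * n) in
  Phi n (1 + l * M ^+ 2) ((l - 1) * (1 - M ^+ 2)) (1 + l * M ^+ 6) (M ^+ 2).

Lemma exp_l (L M : CC) (n : int) (i : nat) : M != 0 ->
  L * M ^ (i%:Z + 4 * n) = L * M ^ (4 * n) * M ^+ i.
Proof. by move=> M0; rewrite expfzDr // -exprnP -mulrA; congr (_ * _); rewrite mulrC. Qed.

Lemma A_formula_nonnegE (k : nat) (L M : CC) : M != 0 ->
  1 + L * M ^ (2 + 4 * k%:Z) != 0 ->
  A_formula_nonneg k L M = M ^ shift_exp k * PhiLM k L M.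
Proof.
move=> M0; rewrite /A_formula_nonneg /PhiLM !(exp_l L k 2) // (exp_l L k 4) //.
rewrite (exp_l L k 6) //; set l := L * M ^ _ => A0.
rewrite Phi_param // -!mulr_suml.
have -> : M ^+ 2 + l * M ^+ 4 = M ^+ 2 * (1 + l * M ^+ 2) by ring.
set A := 1 + _ in A0 *; set X := (l - 1) * _ / _; set Y := (_ + _) / (_ * A).
have -> : M ^ (- (2 * k%:Z)) = M ^ shift_exp k * (M ^+ 2) ^+ k.
  rewrite -exprM exprnP -expfzDr // PoszM; congr (_ ^ _).
  by rewrite /shift_exp; ring.
have -> : A ^ (3 * k%:Z) = A ^+ hdeg k by [].
transitivity (phi k X Y * (M ^ shift_exp k * (M ^+ 2) ^+ k) * A ^+ hdeg k).
  by congr (_ * _ * _); exact: sum_formula_nonneg.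
by rewrite absz_nat; ring.
Qed.

Lemma A_formula_negE (k : nat) (L M : CC) : M != 0 ->
  L * M ^+ 2 + M ^ (- (4 * Negz k)) != 0 ->
  A_formula_neg (Negz k) L M = M ^ shift_exp (Negz k) * PhiLM (Negz k) L M.
Proof.
move=> M0; rewrite /A_formula_neg /PhiLM => A0.
(* Since l = L / v, each fraction of the formula is a fraction in l with numerator and denominator
   multiplied by v. *)
set v := M ^ (- (4 * Negz k)) in A0 *.
have v0 : v != 0 by rewrite expfz_neq0.
have ev : L * M ^ (4 * Negz k) = L / v by rewrite /v -invr_expz invrK.
have e2 : M ^ (2 - 4 * Negz k) = M ^+ 2 * v by rewrite expfzDr.
rewrite e2 ev.
have eA : 1 + L / v * M ^+ 2 = (L * M ^+ 2 + v) / v by field.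
rewrite Phi_param //; last by rewrite eA mulf_neq0 // invr_eq0.
rewrite -!mulr_suml.
set X := (1 - M ^+ 2) * _ / _; set Y := (L * M ^+ 6 + _) / _.
have -> : (L / v - 1) * (1 - M ^+ 2) / (1 + L / v * M ^+ 2) = - X.
  by rewrite eA /X; field; rewrite v0 A0.
have -> : (1 + L / v * M ^+ 6) / (M ^+ 2 * (1 + L / v * M ^+ 2)) = Y.
  rewrite eA /Y; have -> : L * M ^+ 4 + M ^+ 2 * v = M ^+ 2 * (L * M ^+ 2 + v) by ring.
  by field; rewrite ?M0 ?v0 ?A0 ?M0.
set A := L * _ + v.
have -> : A ^ (- (3 * Negz k) - 1) = A ^+ hdeg (Negz k).
  rewrite exprnP; congr (_ ^ _); rewrite /hdeg NegzE intS PoszD PoszM; ring.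
transitivity (phi (Negz k) (- X) Y * M ^ (8 * Negz k + 6) * A ^+ hdeg (Negz k)).
  by congr (_ * _ * _); exact: sum_formula_neg.
rewrite eA expr_div_n -/A.
have -> : M ^ (8 * Negz k + 6) = 
  M ^ shift_exp (Negz k) * (M ^+ 2) ^+ `|Negz k| / v ^+ hdeg (Negz k).
  rewrite -exprM /v exprnP [M ^+ _]exprnP exprz_exp invr_expz.
  rewrite -!expfzDr //; congr (_ ^ _).
  by rewrite /hdeg /shift_exp NegzE abszN absz_nat intS !PoszD !PoszM intS; ring.
ring.
Qed.

Lemma A_formula_Phi n (L M : CC) : formula_defined n L M ->
  A_formula n L M = M ^ shift_exp n * PhiLM n L M.
Proof.
case=> _ [M0]; rewrite /A_formula; case: n => k [A0 _].
  exact: A_formula_nonnegE.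
exact: A_formula_negE.
Qed.

(** * Words in 2x2 matrices *)

Section Matrix2.
Variable F : fieldType.
Implicit Types A B : 'M[F]_2.

Lemma ord2P (P : 'I_2 -> Prop) : P 0 -> P 1 -> forall i, P i.
Proof.
move=> P0 P1 [[|[|//]] Hi]; first by rewrite (_ : Ordinal Hi = 0) //; apply: val_inj.
by rewrite (_ : Ordinal Hi = 1) //; apply: val_inj.
Qed.

Lemma eq_mx2 A B : A 0 0 = B 0 0 -> A 0 1 = B 0 1 -> A 1 0 = B 1 0 ->
  A 1 1 = B 1 1 -> A = B.
Proof.
move=> h00 h01 h10 h11; apply/matrixP => i j; move: i j.
by apply: ord2P; apply: ord2P.
Qed.

Lemma mulmx2E A B i j : (A * B) i j = A i 0 * B 0 j + A i 1 * B 1 j.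
Proof.
rewrite mxE big_ord_recl big_ord1; congr (_ + A i _ * B _ j); exact: val_inj.
Qed.

Lemma mxtrace2E A : \tr A = A 0 0 + A 1 1.
Proof.
rewrite /mxtrace big_ord_recl big_ord1; congr (_ + A _ _); exact: val_inj.
Qed.

Lemma det2E A : \det A = A 0 0 * A 1 1 - A 0 1 * A 1 0.
Proof.
rewrite (expand_det_row _ 0) big_ord_recl big_ord1 /cofactor !det_mx11 !mxE /=.
rewrite expr0 expr1 mul1r mulN1r mulrN.
by congr (A _ _ * A _ _ - A _ _ * A _ _); apply: val_inj.
Qed.

Lemma cayley_hamilton2 A : A * A = \tr A *: A - (\det A)%:A.
Proof.
rewrite mxtrace2E det2E.
by apply: eq_mx2; rewrite mulmx2E !mxE /=; ring.
Qed.

Lemma cayley_hamilton2_polarized A B :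
  A * B + B * A = \tr A *: B + \tr B *: A + (\tr (A * B) - \tr A * \tr B)%:A.
Proof.
rewrite !mxtrace2E !mulmx2E.
by apply: eq_mx2; rewrite mxE !mulmx2E !mxE /=; ring.
Qed.

Lemma unit_det1 A : \det A = 1 -> A \in unitmx.
Proof. by move=> dA; rewrite unitmxE dA unitr1. Qed.

Lemma invmx_det1 A : \det A = 1 -> invmx A = (\tr A)%:A - A.
Proof.
move=> dA; have uA := unit_det1 dA.
apply: (can_inj (mulKmx uA)); rewrite mulmxV // mulmxBr -[A *m A]/(A * A).
by rewrite cayley_hamilton2 dA scale1r -scalemxAr mulmx1 opprB addrC subrK.
Qed.

End Matrix2.

Section Words.
Variables (F : fieldType) (S T : 'M[F]_2).

(** Evaluation over any field; over [CC] it is convertible with [eval_letter] and [eval_word]. *)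
Definition eval_letter_over (l : letter) : 'M[F]_2 :=
  let A := if l.1 then S else T in if l.2 then invmx A else A.
Definition eval_over (u : word) : 'M[F]_2 :=
  foldr (fun l acc => eval_letter_over l *m acc) 1%:M u.

Hypotheses (uS : S \in unitmx) (uT : T \in unitmx).

Lemma eval_cat u v : eval_over (u ++ v) = eval_over u *m eval_over v.
Proof. by elim: u => [|l u IH] /=; rewrite ?mul1mx // IH mulmxA. Qed.

Lemma eval_letter_unit l : eval_letter_over l \in unitmx.
Proof. by case: l => [[] []]; rewrite /eval_letter_over /= ?unitmx_inv. Qed.

Lemma eval_word_unit u : eval_over u \in unitmx.
Proof.
by elim: u => [|l u IH]; rewrite /= ?unitmx1 // unitmx_mul eval_letter_unit.
Qed.

Lemma eval_inv u : eval_over (inv_word u) = invmx (eval_over u).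
Proof.
elim: u => [|l u IH]; first by rewrite /= invmx1.
rewrite /inv_word /= rev_cons -cats1 eval_cat -/(inv_word u) IH /= mulmx1.
have -> : eval_letter_over (l.1, ~~ l.2) = invmx (eval_letter_over l).
  by case: l => [[] []]; rewrite /eval_letter_over /= ?invmxK.
apply: (can_inj (mulKmx (eval_word_unit (l :: u)))).
rewrite mulmxV ?eval_word_unit //= -!mulmxA (mulmxA _ (invmx _) (invmx _)).
by rewrite mulmxV ?eval_word_unit // mul1mx mulmxV ?eval_letter_unit.
Qed.

Lemma eval_flatten_nseq u k :
  eval_over (flatten (nseq k u)) = eval_over u ^+ k.
Proof.
elim: k => [|k IH]; first by rewrite expr0.
by rewrite /= eval_cat IH exprS.
Qed.

Lemma eval_word_pow u n : eval_over (word_pow u n) =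
  match n with Posz k => eval_over u ^+ k
             | Negz k => invmx (eval_over u) ^+ k.+1 end.
Proof. by case: n => k; rewrite eval_flatten_nseq ?eval_inv. Qed.

Lemma rev_flatten_nseq (A : Type) (u : seq A) k :
  rev (flatten (nseq k u)) = flatten (nseq k (rev u)).
Proof. by rewrite rev_flatten map_nseq rev_nseq. Qed.

Lemma rev_word_pow u n : rev (word_pow u n) = word_pow (rev u) n.
Proof.
case: n => k; rewrite /word_pow rev_flatten_nseq //.
by rewrite /inv_word map_rev.
Qed.

Lemma eval_meridian_pow M i : S 1 0 = 0 -> S 0 0 = M -> M != 0 ->
  let W := eval_over (word_pow [:: ls] i) in W 1 0 = 0 /\ W 0 0 = M ^ i.
Proof.
move=> S10 S00 M0 /=; rewrite eval_word_pow /= mulmx1 /eval_letter_over /=.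
have pow (A : 'M[F]_2) m k : A 1 0 = 0 -> A 0 0 = m -> (A ^+ k) 1 0 = 0 /\ (A ^+ k) 0 0 = m ^+ k.
  move=> A10 A00; elim: k => [|k [IH1 IH0]]; first by rewrite !expr0 !mxE.
  by rewrite !exprS !mulmx2E IH1 IH0 A10 A00; split; ring.
case: i => k; first exact: pow.
have [I10 I00] : (invmx S) 1 0 = 0 /\ (invmx S) 0 0 = M^-1.
  have := mulVmx uS; rewrite -[_ *m _]/(_ * _) => /matrixP e.
  have := e 1 0; rewrite mulmx2E S10 mulr0 addr0 S00 [RHS]mxE /= => h.
  split; first by apply: (mulIf M0); rewrite h mul0r.
  have := e 0 0; rewrite mulmx2E S10 mulr0 addr0 S00 [RHS]mxE /= => h0.
  by apply: (mulIf M0); rewrite h0 mulVf.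
by have [? ->] := pow _ _ k.+1 I10 I00; split=> //; rewrite exprVn NegzE -exprnN.
Qed.

End Words.

(** * The trace algebra of two matrices *)

(* Arithmetic in the algebra spanned by 1, P, Q, PQ, where P = rho(s)^-1 and
   Q = rho(t)^-1 have common trace x, and X = x^2 - 1 - tr(PQ). *)
Section TraceAlgebra.
Variables (F : fieldType) (x X : F) (P Q : 'M[F]_2).
Hypotheses (PP : P * P = x *: P - 1) (QQ : Q * Q = x *: Q - 1).
Hypothesis QP : Q * P = - (P * Q) + x *: P + x *: Q - (1 + X)%:A.

Let Y := x ^+ 2 - 3 - X.
Let z := X ^+ 2 * Y.
Let y := x ^+ 2 - 1 - X.

Definition comb a0 a1 a2 a3 : 'M[F]_2 := a0%:A + a1 *: P + a2 *: Q + a3 *: (P * Q).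

Lemma combM a0 a1 a2 a3 b0 b1 b2 b3 :
  comb a0 a1 a2 a3 * comb b0 b1 b2 b3 =
  comb (a0 * b0 - a1 * b1 - a2 * b2 - (1 + X) * (a2 * b1) - x * (a2 * b3)
        - x * (a3 * b1) - a3 * b3)
       (a0 * b1 + a1 * b0 + x * (a1 * b1) + x * (a2 * b1) + a2 * b3
        + y * (a3 * b1) - a3 * b2)
       (a0 * b2 + a2 * b0 + x * (a2 * b2) + x * (a2 * b1) + y * (a2 * b3)
        + a3 * b1 - a1 * b3)
       (a0 * b3 + a3 * b0 + a1 * b2 - a2 * b1 + x * (a1 * b3) + x * (a3 * b2)
        + y * (a3 * b3)).
Proof.
have PG : P * (P * Q) = x *: (P * Q) - Q.
  by rewrite mulrA PP mulrBl mul1r -scalerAl.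
have GQ : P * Q * Q = x *: (P * Q) - P.
  by rewrite -mulrA QQ mulrBr mulr1 -scalerAr.
have QG : Q * (P * Q) = P + y *: Q - x%:A.
  rewrite mulrA QP !mulrDl !mulNr GQ -!scalerAl QQ mul1r.
  by apply/matrixP => i j; rewrite !mxE /y; ring.
have GP : P * Q * P = Q + y *: P - x%:A.
  rewrite -mulrA QP !mulrDr !mulrN PG -!scalerAr PP mulr1.
  by apply/matrixP => i j; rewrite !mxE /y; ring.
have GG : P * Q * (P * Q) = y *: (P * Q) - 1.
  rewrite mulrA GP !mulrDl mulNr -!scalerAl QQ mul1r.
  by apply/matrixP => i j; rewrite !mxE; ring.
rewrite /comb !mulrDl !mulrDr -!scalerAl -!scalerAr !mul1r !mulr1.
rewrite PG GQ QG GP GG PP QQ QP; set G := P * Q.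
by apply/matrixP => i j; rewrite !mxE /y; ring.
Qed.

Lemma combD a0 a1 a2 a3 b0 b1 b2 b3 :
  comb a0 a1 a2 a3 + comb b0 b1 b2 b3 = comb (a0 + b0) (a1 + b1) (a2 + b2) (a3 + b3).
Proof.
by rewrite /comb; set G := P * Q; apply/matrixP => i j; rewrite !mxE; ring.
Qed.

Lemma combZ c a0 a1 a2 a3 :
  c *: comb a0 a1 a2 a3 = comb (c * a0) (c * a1) (c * a2) (c * a3).
Proof.
by rewrite /comb; set G := P * Q; apply/matrixP => i j; rewrite !mxE; ring.
Qed.

Lemma comb_scalar c : c%:A = comb c 0 0 0.
Proof. by rewrite /comb !scale0r !addr0. Qed.

Lemma combP : P = comb 0 1 0 0.
Proof. by rewrite /comb !scale0r scale1r add0r !addr0. Qed.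

Lemma combQ : Q = comb 0 0 1 0.
Proof. by rewrite /comb !scale0r scale1r !add0r !addr0. Qed.

Let S := comb x (-1) 0 0.
Let T := comb x 0 (-1) 0.

(* V and V' are the inverses of rho(u) and of its reversal. *)
Let V := comb (1 + X) (- (x * X)) (- (x * X)) (X * (X + 2)).
Let V' := comb (1 + X - X * (X + 2) * (1 + X)) (X * (X + 2) * x - x * X)
  (X * (X + 2) * x - x * X) (- (X * (X + 2))).

Lemma TPT : T * (P * T) = comb (X * x) 1 (- (1 + X)) 0.
Proof. by rewrite [in LHS]combP /T !combM; congr comb; rewrite /y; ring. Qed.

Lemma SQS : S * (Q * S) = comb (X * x) (- (1 + X)) 1 0.
Proof. by rewrite [in LHS]combQ /S !combM; congr comb; rewrite /y; ring. Qed.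

Lemma u_inverse : T * (P * (T * (S * (Q * S)))) = (z + 2)%:A - V.
Proof.
rewrite SQS (mulrA P) mulrA TPT combM comb_scalar -scaleN1r /V combZ combD.
by congr comb; rewrite /z /Y /y; ring.
Qed.

Lemma u_rev_inverse : S * (Q * (S * (T * (P * T)))) = (z + 2)%:A - V'.
Proof.
rewrite TPT (mulrA Q) mulrA SQS combM comb_scalar -scaleN1r /V' combZ combD.
by congr comb; rewrite /z /Y /y; ring.
Qed.

Lemma V_sq : V * V = (z + 2) *: V - 1.
Proof.
rewrite -[in RHS](scale1r 1) comb_scalar -scaleN1r /V !combZ combD combM.
by congr comb; rewrite /z /Y /y; ring.
Qed.

Lemma V'_sq : V' * V' = (z + 2) *: V' - 1.
Proof.
rewrite -[in RHS](scale1r 1) comb_scalar -scaleN1r /V' !combZ combD combM.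
by congr comb; rewrite /z /Y /y; ring.
Qed.

Let W e o := e%:A + o *: (1 - V).
Let W' e o := e%:A + o *: (1 - V').

Lemma W_comb e o : W e o = comb (e - o * X) (o * (x * X)) (o * (x * X)) (- (o * (X * (X + 2)))).
Proof.
rewrite /W -[X in X - V](scale1r 1) !comb_scalar -scaleN1r /V !(combZ, combD).
by congr comb; ring.
Qed.

Lemma W'_comb e o : W' e o =
  comb (e + o * (X * (X + 2) * (1 + X) - X)) (- (o * (X * (X + 2) * x - x * X)))
   (- (o * (X * (X + 2) * x - x * X))) (o * (X * (X + 2))).
Proof.
rewrite /W' -[X in X - V'](scale1r 1) !comb_scalar -scaleN1r /V' !(combZ, combD).
by congr comb; ring.
Qed.

(** This makes the group relation a single equation: when S and T differ, sw = wt holds exactly if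
    the scalar e + o X Y vanishes. *)
Lemma riley_relation e o : S * W e o - W e o * T = (e + o * (X * Y)) *: (S - T).
Proof.
rewrite W_comb /S /T !combM -!scaleN1r !(combZ, combD).
by congr comb; rewrite /Y /y; ring.
Qed.

(** The choice e = - o X Y is the Riley equation. Under it the Q and PQ coordinates of the product
    cancel, so the result is a polynomial in P alone. *)
Lemma longitude_matrix o : W (- (o * (X * Y))) o * W' (- (o * (X * Y))) o =
  (o ^+ 2 * X ^+ 2 * Y) *: ((X * (X + 2) * x) *: P + (x ^+ 2 - (X + 2) ^+ 2)%:A).
Proof.
rewrite W_comb W'_comb combM [P in RHS]combP comb_scalar !(combZ, combD).
by congr comb; rewrite /Y /y; ring.
Qed.

End TraceAlgebra.

(** * Powers of u, the relation and the longitude in a representation *)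

Section PowCoef.
Variable R : comNzRingType.
Implicit Types (z : R) (n : int).

(* u^n = powE n z + powO n z * (1 - u^-1) in SL2, with tr u = z + 2. *)
Definition powE n z : R :=
  match n with Posz k => chebE z 1 k | Negz k => chebE z 1 k end.
Definition powO n z : R :=
  match n with Posz k => chebO z 1 k | Negz k => - chebO z 1 k.+1 end.

Lemma phiE n (X Y : R) :
  phi n X Y = powE n (X ^+ 2 * Y) + powO n (X ^+ 2 * Y) * (X * Y).
Proof. by case: n => k; rewrite /phi /=; ring. Qed.

(** Says det u^n = 1: the matrix 1 - u^-1 has trace and determinant -z, so the left side is the
    determinant of e + o (1 - u^-1). *)
Lemma pow_norm n z : powE n z ^+ 2 - z * powE n z * powO n z - z * powO n z ^+ 2 = 1.
Proof.
have h k : chebE z 1 k ^+ 2 - z * chebE z 1 k * chebO z 1 k - z * chebO z 1 k ^+ 2 = 1.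
  elim: k => [|k IH]; first by rewrite chebE0 chebO0; ring.
  by rewrite -[RHS]IH chebES chebOS; ring.
case: n => k; first exact: h.
by rewrite -[RHS](h k) /powE /powO chebOS; ring.
Qed.

End PowCoef.

Lemma mx_pow (F : fieldType) (z : F) (U V : 'M[F]_2) n :
  V * V = (z + 2) *: V - 1 -> U = (z + 2)%:A - V ->
  match n with Posz k => U ^+ k | Negz k => invmx U ^+ k.+1 end =
  (powE n z)%:A + powO n z *: (1 - V).
Proof.
move=> VV UE.
have UV : U * V = 1 by rewrite UE mulrBl -scalerAl mul1r VV opprB addrC subrK.
have [uU _] := mulmx1_unit UV.
have -> : invmx U = V by rewrite -[LHS]mulmx1 -[1%:M]UV -[U * V]/(U *m V) mulKmx.
case: n => k.
  elim: k => [|k IH].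
    by rewrite /powE /powO chebE0 chebO0 expr0 scale0r addr0 scale1r.
  rewrite exprS IH UE /powE /powO chebES chebOS.
  rewrite mulrDr -!scalerAr !mulrBl !mulrBr !mulr1 -!scalerAl !mul1r VV.
  by apply/matrixP => i j; rewrite !mxE; ring.
elim: k => [|k IH].
  rewrite expr1 /powE /powO chebOS chebE0 chebO0.
  by apply/matrixP => i j; rewrite !mxE; ring.
rewrite exprS IH /powE /powO (chebOS _ _ k.+1) chebES.
rewrite mulrDr -!scalerAr mulrBr !mulr1 VV.
by apply/matrixP => i j; rewrite !mxE; ring.
Qed.

Section Representation.
Variables (F : fieldType) (S T : 'M[F]_2) (x X : F).
Hypotheses (dS : \det S = 1) (dT : \det T = 1).
Hypotheses (tS : \tr S = x) (tT : \tr T = x).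
Hypothesis tPQ : \tr (invmx S * invmx T) = x ^+ 2 - 1 - X.
Variable n : int.

Let Y := x ^+ 2 - 3 - X.
Let P := invmx S.
Let Q := invmx T.
Let U := T * (P * (T * (S * (Q * S)))).
Let Us := S * (Q * (S * (T * (P * T)))).
Let W := match n with Posz k => U ^+ k | Negz k => invmx U ^+ k.+1 end.
Let Ws := match n with Posz k => Us ^+ k | Negz k => invmx Us ^+ k.+1 end.
Let o := powO n (X ^+ 2 * Y).

Let PE : P = x%:A - S. Proof. by rewrite /P invmx_det1 // tS. Qed.
Let QE : Q = x%:A - T. Proof. by rewrite /Q invmx_det1 // tT. Qed.

Let tr_scal : \tr (x%:A : 'M[F]_2) = x + x.
Proof. by rewrite linearZ /= mxtrace1 mulr_natr mulr2n. Qed.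

Let PP : P * P = x *: P - 1.
Proof.
rewrite cayley_hamilton2 det_inv dS invr1 scale1r; congr (_ *: _ - _).
by rewrite PE linearB /= tr_scal tS addrK.
Qed.

Let QQ : Q * Q = x *: Q - 1.
Proof.
rewrite cayley_hamilton2 det_inv dT invr1 scale1r; congr (_ *: _ - _).
by rewrite QE linearB /= tr_scal tT addrK.
Qed.

Let QP : Q * P = - (P * Q) + x *: P + x *: Q - (1 + X)%:A.
Proof.
have := cayley_hamilton2_polarized P Q.
have -> : \tr P = x by rewrite PE linearB /= tr_scal tS addrK.
have -> : \tr Q = x by rewrite QE linearB /= tr_scal tT addrK.
rewrite tPQ => h; rewrite -[LHS](addKr (P * Q)) h; set G := P * Q.
by apply/matrixP => i j; rewrite !mxE; ring.
Qed.

Let SE : S = comb P Q x (-1) 0 0.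
Proof. by rewrite /comb !scale0r !addr0 scaleN1r PE opprB addrC subrK. Qed.

Let TE : T = comb P Q x 0 (-1) 0.
Proof. by rewrite /comb !scale0r !addr0 scaleN1r QE opprB addrC subrK. Qed.

Let V := comb P Q (1 + X) (- (x * X)) (- (x * X)) (X * (X + 2)).
Let V' := comb P Q (1 + X - X * (X + 2) * (1 + X)) (X * (X + 2) * x - x * X)
  (X * (X + 2) * x - x * X) (- (X * (X + 2))).
Let e := powE n (X ^+ 2 * Y).

Let WE : W = e%:A + o *: (1 - V).
Proof.
apply: mx_pow; first exact: V_sq.
by rewrite /U {1 2}SE {1 2}TE; exact: u_inverse.
Qed.

Let WsE : Ws = e%:A + o *: (1 - V').
Proof.
apply: mx_pow; first exact: V'_sq.
by rewrite /Us {1 2}SE {1 2}TE; exact: u_rev_inverse.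
Qed.

Lemma rep_relator : S * W - W * T = phi n X Y *: (S - T).
Proof.
by rewrite phiE -/e -/o WE {1 2}SE {1 2}TE; exact: riley_relation.
Qed.

Lemma rep_longitude : phi n X Y = 0 ->
  W * Ws = (o ^+ 2 * X ^+ 2 * Y) *:
    ((X * (X + 2) * x) *: P + (x ^+ 2 - (X + 2) ^+ 2)%:A).
Proof.
rewrite phiE -/e -/o => /eqP; rewrite addr_eq0 => /eqP e0.
by rewrite WE WsE e0; exact: longitude_matrix.
Qed.

(** [pow_norm] at e = - o X Y. The scalar in front of [rep_longitude] is thus the inverse of Y - 1 +
    X Y, which removes n from the longitude. *)
Lemma rep_norm : phi n X Y = 0 -> o ^+ 2 * X ^+ 2 * Y * (Y - 1 + X * Y) = 1.
Proof.
rewrite phiE => /eqP; rewrite addr_eq0 => /eqP e0.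
by rewrite -[RHS](pow_norm n (X ^+ 2 * Y)) e0 /o; ring.
Qed.

End Representation.

(** * Eigenvalues of the meridian and the longitude *)

(** Here k is the scalar of [rep_longitude] and M^-1 the upper-left entry of P, so l is the
    eigenvalue of the product of w and its reversal. Multiplying by k^-1 leaves an identity in X and
    M. *)
Lemma longitude_param (F : fieldType) (M X k l : F) :
  let x := M + M^-1 in let Y := x ^+ 2 - 3 - X in
  M != 0 -> k * (Y - 1 + X * Y) = 1 ->
  l = k * (X * (X + 2) * x * M^-1 + (x ^+ 2 - (X + 2) ^+ 2)) ->
  X * (1 + l * M ^+ 2) = (l - 1) * (1 - M ^+ 2).
Proof.
move=> x Y M0 hk ->; set m := X * (X + 2) * x * M^-1 + _.
set d := Y - 1 + X * Y in hk.
have key : X * (d + m * M ^+ 2) = (m - d) * (1 - M ^+ 2).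
  by rewrite /m /d /Y /x; field; rewrite M0.
transitivity (k * (X * (d + m * M ^+ 2))); first by rewrite -hk; ring.
by rewrite key -[X in _ = (_ - X) * _]hk; ring.
Qed.

(** The relation also forces C = A M^2 Y, so (A, B, C) = A (1, X, M^2 Y) and homogeneity reduces
    [Phi] to [phi]. Nothing is divided by A, so A = 0 is allowed. *)
Lemma Phi_of_param n (F : fieldType) (M X l : F) : M != 0 ->
  let Y := (M + M^-1) ^+ 2 - 3 - X in
  X * (1 + l * M ^+ 2) = (l - 1) * (1 - M ^+ 2) -> phi n X Y = 0 ->
  Phi n (1 + l * M ^+ 2) ((l - 1) * (1 - M ^+ 2)) (1 + l * M ^+ 6) (M ^+ 2) = 0.
Proof.
move=> M0 Y hX h0.
have hC : 1 + l * M ^+ 6 = (1 + l * M ^+ 2) * (M ^+ 2 * Y).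
  transitivity ((1 + l * M ^+ 2) * (M ^+ 2 * ((M + M^-1) ^+ 2 - 3)) -
                M ^+ 2 * (X * (1 + l * M ^+ 2))); last by rewrite /Y; ring.
  by rewrite hX; field; rewrite M0.
rewrite hC -hX; set A := 1 + l * _.
have -> : Phi n A (X * A) (A * (M ^+ 2 * Y)) (M ^+ 2) =
    Phi n (A * 1) (A * X) (A * (M ^+ 2 * Y)) (M ^+ 2).
  by rewrite mulr1 (mulrC X).
by rewrite Phi_scale Phi_phi h0 !mulr0.
Qed.

Lemma eval_w_word n (F : fieldType) (S T : 'M[F]_2) : S \in unitmx -> T \in unitmx ->
  let U := T * (invmx S * (T * (S * (invmx T * S)))) in
  eval_over S T (w_word n) =
  match n with Posz k => U ^+ k | Negz k => invmx U ^+ k.+1 end.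
Proof.
move=> uS uT U; rewrite /w_word (eval_word_pow uS uT).
have -> : eval_over S T u_word = U; last by [].
by rewrite /u_word /eval_over /foldr mulmx1.
Qed.

Lemma eval_wstar_word n (F : fieldType) (S T : 'M[F]_2) : S \in unitmx -> T \in unitmx ->
  let U := S * (invmx T * (S * (T * (invmx S * T)))) in
  eval_over S T (wstar_word n) =
  match n with Posz k => U ^+ k | Negz k => invmx U ^+ k.+1 end.
Proof.
move=> uS uT U; rewrite /wstar_word /w_word rev_word_pow (eval_word_pow uS uT).
have -> : rev u_word = [:: ls; lti; ls; lt; lsi; lt] by [].
have -> : eval_over S T [:: ls; lti; ls; lt; lsi; lt] = U; last by [].
by rewrite /eval_over /foldr mulmx1.
Qed.

Lemma eval_relator n (F : fieldType) (S T : 'M[F]_2) : S \in unitmx -> T \in unitmx ->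
  let W := eval_over S T (w_word n) in
  eval_over S T (relator n) = 1%:M <-> S *m W = W *m T.
Proof.
move=> uS uT W; have uW : W \in unitmx by apply: eval_word_unit.
have -> : eval_over S T (relator n) = S *m W *m invmx T *m invmx W.
  rewrite /relator !eval_cat eval_inv // -/W !mulmxA.
  by rewrite /eval_over /foldr !mulmx1.
split=> [h|->]; last by rewrite mulmxK // mulmxV.
by rewrite -[LHS](mulmxKV uT) -[S *m W *m invmx T](mulmxKV uW) h mul1mx.
Qed.

Lemma eval_longitude n (F : fieldType) (S T : 'M[F]_2) (M k a b : F) :
  S \in unitmx -> T \in unitmx -> S 1 0 = 0 -> S 0 0 = M -> M != 0 ->
  eval_over S T (w_word n) * eval_over S T (wstar_word n) =
    k *: (a *: invmx S + b%:A) ->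
  let Z := eval_over S T (longitude n) in
  Z 1 0 = 0 /\ Z 0 0 = k * (a * M^-1 + b) * M ^ (- (4 * n)).
Proof.
move=> uS uT S10 S00 M0 hW Z.
have {}hW : Z = k *: (a *: invmx S + b%:A) * eval_over S T (word_pow [:: ls] (- (4 * n))).
  by rewrite -hW /Z /longitude !eval_cat mulmxA.
have [D10 D00] := @eval_meridian_pow _ S T uS uT M (- (4 * n)) S10 S00 M0.
have [I10 I00] := @eval_meridian_pow _ S T uS uT M (-1) S10 S00 M0.
have eI : eval_over S T (word_pow [:: ls] (-1)) = invmx S.
  by rewrite /word_pow /= mulmx1.
rewrite eI in I10 I00.
rewrite hW !mulmx2E D10 D00 !mxE I10 I00 /=; split; first by ring.
by rewrite /exprz /= expr1; ring.
Qed.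

Definition eigen_over (F : fieldType) n (L M : F) : Prop :=
  exists S T : 'M[F]_2,
    (\det S = 1 /\ \det T = 1 /\ eval_over S T (relator n) = 1%:M) /\
    S *m T <> T *m S /\ S 1 0 = 0 /\ (eval_over S T (longitude n)) 1 0 = 0 /\
    S 0 0 = M /\ (eval_over S T (longitude n)) 0 0 = L.

Lemma eigen_over_Phi (F : fieldType) n (L M : F) : M != 0 -> eigen_over n L M ->
  let l := L * M ^ (4 * n) in
  Phi n (1 + l * M ^+ 2) ((l - 1) * (1 - M ^+ 2)) (1 + l * M ^+ 6) (M ^+ 2) = 0.
Proof.
move=> M0 [S [T [[dS [dT hrel]] [nab [S10 [Z10 [S00 Z00]]]]]]] l.
have uS := unit_det1 dS; have uT := unit_det1 dT.
have /(eval_relator n uS uT) hWT := hrel.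
have uW := eval_word_unit uS uT (w_word n).
set x := M + M^-1.
have tS : \tr S = x.
  rewrite mxtrace2E S00; congr (_ + _).
  have := dS; rewrite det2E S10 mulr0 subr0 S00 => h.
  by apply: (mulfI M0); rewrite h mulfV.
have tT : \tr T = x.
  by rewrite -tS -[T](mulKmx uW) -hWT mulmxA mxtrace_mulC mulmxA mulmxV // mul1mx.
set X := x ^+ 2 - 1 - \tr (invmx S * invmx T).
have tPQ : \tr (invmx S * invmx T) = x ^+ 2 - 1 - X by rewrite /X opprB addrC subrK.
have h0 : phi n X (x ^+ 2 - 3 - X) = 0.
  have := rep_relator dS dT tS tT tPQ n; rewrite -(eval_w_word n uS uT).
  rewrite -!mulmxE hWT subrr => /esym /eqP.
  rewrite scaler_eq0 => /orP [/eqP //|/eqP /subr0_eq eST].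
  by case: nab; rewrite eST.
have hW := rep_longitude dS dT tS tT tPQ h0.
rewrite -(eval_w_word n uS uT) -(eval_wstar_word n uS uT) in hW.
have [_] := eval_longitude uS uT S10 S00 M0 hW; rewrite Z00 => eL.
apply: (Phi_of_param M0 _ h0).
apply: (longitude_param M0 (rep_norm h0)).
by rewrite /l eL -mulrA -expfzDr // addNr expr0z mulr1.
Qed.

(** At A = 0 also b = 0, and by [cheb_a0] only a monomial in B and C survives. *)
Lemma Phi_A0 (R : idomainType) n (B C x : R) : B != 0 -> C != 0 -> Phi n 0 B C x != 0.
Proof.
move=> B0 C0; have a0 k : (B ^+ 2 * C) ^+ k != 0.
  by rewrite expf_neq0 // mulf_neq0 // expf_neq0.
case: n => k; rewrite /Phi !expr0n /= !mulr0.
  by rewrite mul0r addr0 (cheb_a0 _ k).1.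
by rewrite mul0r add0r oppr_eq0 (cheb_a0 _ k).2 mulf_neq0 // mulf_neq0.
Qed.

(** The condition on M makes A nonzero on the curve, by [Phi_A0]. Then X = B / A is defined, and
    matrices with this X realize the point. *)
Lemma Phi_eigen_over (F : fieldType) n (L M : F) : M != 0 -> M ^+ 4 != 1 ->
  let l := L * M ^ (4 * n) in
  Phi n (1 + l * M ^+ 2) ((l - 1) * (1 - M ^+ 2)) (1 + l * M ^+ 6) (M ^+ 2) = 0 ->
  eigen_over n L M.
Proof.
move=> M0 M4 l hPhi.
have M2 : 1 - M ^+ 2 != 0.
  apply: contraNneq M4 => /subr0_eq h; by rewrite (exprM M 2 2) -h expr1n.
have M2' : 1 + M ^+ 2 != 0.
  apply: contraNneq M4 => h; have -> : M ^+ 4 = (1 + M ^+ 2) * (M ^+ 2 - 1) + 1 by ring.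
  by rewrite h mul0r add0r.
have A0 : 1 + l * M ^+ 2 != 0.
  apply: contraTneq isT => hA; move: hPhi; rewrite hA.
  have hl : l = - (M ^+ 2)^-1.
    apply: (mulIf (expf_neq0 2 M0)); rewrite mulNr mulVf ?expf_neq0 //.
    by apply/eqP; rewrite -addr_eq0 addrC hA.
  set B := (l - 1) * _; set C := 1 + _.
  have B0 : B != 0.
    rewrite mulf_neq0 // hl -opprD oppr_eq0.
    have -> : (M ^+ 2)^-1 + 1 = (1 + M ^+ 2) / M ^+ 2 by field; rewrite M0.
    by rewrite mulf_neq0 // invr_neq0 // expf_neq0.
  have C0 : C != 0.
    have -> : C = (1 - M ^+ 2) * (1 + M ^+ 2) by rewrite /C hl; field; rewrite M0.
    by rewrite mulf_neq0.
  by move/eqP; rewrite (negPf (Phi_A0 n _ B0 C0)).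
set x := M + M^-1.
set X := (l - 1) * (1 - M ^+ 2) / (1 + l * M ^+ 2).
set Y := x ^+ 2 - 3 - X.
have hX : X * (1 + l * M ^+ 2) = (l - 1) * (1 - M ^+ 2) by rewrite /X mulfVK.
have hY : M ^+ 2 * Y * (1 + l * M ^+ 2) = 1 + l * M ^+ 6.
  transitivity (M ^+ 2 * (x ^+ 2 - 3) * (1 + l * M ^+ 2) - M ^+ 2 * (X * (1 + l * M ^+ 2))).
    by rewrite /Y; ring.
  by rewrite hX /x; field; rewrite M0.
have h0 : phi n X Y = 0.
  move: hPhi; rewrite -hX -hY -[X in Phi _ X]mulr1.
  rewrite (mulrC X) (mulrC (M ^+ 2 * Y)) Phi_scale Phi_phi => /eqP.
  by rewrite !mulf_eq0 !(expf_eq0, negPf A0, negPf M0) !andbF /= => /eqP.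
(* Riley's normal form; the lower-left entry 1 - X is chosen to give tr(S^-1 T^-1) = x^2 - 1 - X. *)
pose S : 'M[F]_2 := \matrix_(i, j)
  if i == 0 then (if j == 0 then M else 1) else (if j == 0 then 0 else M^-1).
pose T : 'M[F]_2 := \matrix_(i, j)
  if i == 0 then (if j == 0 then M else 0) else (if j == 0 then 1 - X else M^-1).
have dS : \det S = 1 by rewrite det2E !mxE /= mulr0 subr0 mulfV.
have dT : \det T = 1 by rewrite det2E !mxE /= mul0r subr0 mulfV.
have uS := unit_det1 dS; have uT := unit_det1 dT.
have tS : \tr S = x by rewrite mxtrace2E !mxE.
have tT : \tr T = x by rewrite mxtrace2E !mxE.
have tPQ : \tr (invmx S * invmx T) = x ^+ 2 - 1 - X.
  rewrite !invmx_det1 // tS tT mxtrace2E !mulmx2E !mxE /= /x.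
  by field; rewrite M0.
have hWT := rep_relator dS dT tS tT tPQ n.
rewrite -(eval_w_word n uS uT) h0 scale0r in hWT.
have hW := rep_longitude dS dT tS tT tPQ h0.
rewrite -(eval_w_word n uS uT) -(eval_wstar_word n uS uT) in hW.
have S10 : S 1 0 = 0 by rewrite mxE.
have S00 : S 0 0 = M by rewrite mxE.
have [Z10 Z00] := eval_longitude uS uT S10 S00 M0 hW.
exists S, T; split; last split; last split=> //; last split=> //; last split=> //.
- by do 2!split=> //; apply/(eval_relator n uS uT); apply: subr0_eq.
- rewrite !mulmxE => /matrixP e.
  have := e 0 0; rewrite !mulmx2E !mxE /= mul1r mul0r addr0 => /eqP.
  rewrite -subr_eq0 addrC addrA addNr add0r => /eqP hX1.
  have := e 0 1; rewrite !mulmx2E !mxE /= mulr0 mul0r mul1r add0r addr0 mulr1 => hM.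
  move: M2; rewrite -[in X in X - _](mulfV M0) hM expr2 subrr eqxx //.
- rewrite Z00; set l' := _ * (_ + _).
  have hl' : X * (1 + l' * M ^+ 2) = (l' - 1) * (1 - M ^+ 2).
    exact: (longitude_param M0 (rep_norm h0) (erefl l')).
  have -> : l' = l; last by rewrite /l -mulrA -expfzDr // subrr expr0z mulr1.
  (* Both l and l' solve the same equation, linear in the unknown. If its slope X M^2 - (1 - M^2)
     vanished, the equation would force (1 - M^2)(1 + M^2) = 0. *)
  have hlin : (l' - l) * (X * M ^+ 2 - (1 - M ^+ 2)) = 0.
    transitivity ((X * (1 + l' * M ^+ 2) - (l' - 1) * (1 - M ^+ 2)) -
                  (X * (1 + l * M ^+ 2) - (l - 1) * (1 - M ^+ 2))); first by ring.
    by rewrite hl' hX !subrr.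
  move/eqP: hlin; rewrite mulf_eq0 => /orP [/eqP /subr0_eq //|/eqP /subr0_eq hXm].
  have : (1 - M ^+ 2) * (1 + M ^+ 2) = 0.
    transitivity (M ^+ 2 * ((X * (1 + l * M ^+ 2) - (l - 1) * (1 - M ^+ 2))
      - l * (X * M ^+ 2 - (1 - M ^+ 2))) - (X * M ^+ 2 - (1 - M ^+ 2))); first by ring.
    by rewrite hX hXm !(subrr, mulr0, subr0).
  by move/eqP; rewrite mulf_eq0 (negPf M2) (negPf M2').
Qed.

(** * Polynomiality *)

Section BivariatePolynomials.
Variable F : fieldType.
Implicit Types (P Q : {poly {poly F}}) (L M : F).

(* The outer variable is L and the inner one M here; ev2 uses the opposite
   order, whence the use of swapXY below. *)
Definition evLM L M : {poly {poly F}} -> F := horner_eval M \o horner_eval L%:P.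
HB.instance Definition _ L M :=
  GRing.RMorphism.copy (evLM L M) (horner_eval M \o horner_eval L%:P).

Definition slice M P : {poly F} := map_poly (horner_eval M) P.

Lemma evLME L M P : evLM L M P = P.[L%:P].[M].
Proof. by []. Qed.

Lemma horner_slice P (a : {poly F}) M : P.[a].[M] = (slice M P).[a.[M]].
Proof. by rewrite /slice -[a.[M]]/(horner_eval M a) horner_map. Qed.

Lemma evLM_slice P L M : evLM L M P = (slice M P).[L].
Proof. by rewrite evLME horner_slice hornerC. Qed.

End BivariatePolynomials.

Lemma poly_split0 (R : comNzRingType) (N : {poly R}) :
  exists N1, N = N.[0]%:P + 'X * N1.
Proof.
have /factor_theorem [N1 h] : root (N - N.[0]%:P) 0.
  by rewrite /root hornerD hornerN hornerC subrr.
by exists N1; rewrite -[LHS](subrK N.[0]%:P) h subr0 addrC mulrC.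
Qed.

(** * Clearing powers of M from Phi *)

Section CorePolynomial.
Variable F : fieldType.
Implicit Types (L M : F).

(** For n = -(k + 1): what is left of [Phi] when A carries a factor x, C a factor x^3, and the
    common power of x is removed as in [Phi_Psi]. *)
Definition Psi (R : comNzRingType) k (A B C x : R) : R :=
  A ^+ 2 * chebE (B ^+ 2 * C) (x * A ^+ 3) k
  - B * C * chebO (B ^+ 2 * C) (x * A ^+ 3) k.+1.

Lemma Phi_Psi (R : comNzRingType) k (A B C x : R) :
  Phi (Negz k) (x * A) B (x ^+ 3 * C) x = x ^+ (3 * k.+1) * Psi k A B C x.
Proof.
rewrite /Phi /Psi; have -> : B ^+ 2 * (x ^+ 3 * C) = x ^+ 3 * (B ^+ 2 * C) by ring.
have -> : x * (x * A) ^+ 3 = x ^+ 3 * (x * A ^+ 3) by ring.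
by rewrite chebE_scale chebO_scale -exprM mulnS exprD; ring.
Qed.

Lemma Psi_V0 (R : comNzRingType) k (L x : R) :
  Psi k L (L * (1 - x)) L x = L ^+ (3 * k + 2) * x ^+ (2 * k + 1).
Proof.
rewrite /Psi; have -> : (L * (1 - x)) ^+ 2 * L = L ^+ 3 * (1 - x) ^+ 2 by ring.
rewrite (mulrC x) chebE_scale chebO_scale -exprM 2!exprD -chebE_sq chebOS.
by ring.
Qed.

Lemma Psi_rmorph (R S : comNzRingType) (f : {rmorphism R -> S}) k (A B C x : R) :
  f (Psi k A B C x) = Psi k (f A) (f B) (f C) (f x).
Proof.
by rewrite /Psi rmorphB !rmorphM ?rmorphXn (cheb_rmorph f _ _ _).1
  (cheb_rmorph f _ _ _).2 !(rmorphM, rmorphXn).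
Qed.

(** For x = M^2 the constant term x^(2k) is M^(4k), which also divides l = L M^(4k). Dividing by it
    leaves 1 + L q. *)
Lemma Phi_expand_l (R : comNzRingType) k (l x : R) :
  exists q, Phi (Posz k) (1 + l * x) ((l - 1) * (1 - x)) (1 + l * x ^+ 3) x =
            x ^+ (2 * k) + l * q.
Proof.
pose N : {poly R} := Phi (Posz k) (1 + 'X * x%:P) (('X - 1) * (1 - x%:P))
  (1 + 'X * x%:P ^+ 3) x%:P.
have NE v : N.[v] = Phi (Posz k) (1 + v * x) ((v - 1) * (1 - x)) (1 + v * x ^+ 3) x.
  rewrite -[N.[v]]/(horner_eval v N) (Phi_rmorph (horner_eval v)) /= !horner_evalE.
  by rewrite !hornerE.
have [N1 hN] := poly_split0 N.
exists N1.[l]; rewrite -NE hN hornerD hornerM hornerX hornerC NE.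
by rewrite !mul0r !addr0 sub0r mulN1r Phi_at_l0.
Qed.

(** To be used with x = M^2 and V = M^(-4n-6), n = -(k + 1), where x^(2k+1) = V M^4: then V divides
    the whole. The value of q at L = 1, x = V = 0 shows that no further M can be removed. *)
Lemma Psi_expand_V (R : comNzRingType) (F' : fieldType) k (L V x : R) :
  exists2 q,
    Psi k (L + x ^+ 2 * V) ((L - x ^+ 3 * V) * (1 - x)) (L + V) x =
    L ^+ (3 * k + 2) * x ^+ (2 * k + 1) + V * q &
    forall f : {rmorphism R -> F'}, f L = 1 -> f x = 0 -> f V = 0 -> f q = -1.
Proof.
pose N : {poly R} := Psi k (L%:P + x%:P ^+ 2 * 'X)
  ((L%:P - x%:P ^+ 3 * 'X) * (1 - x%:P)) (L%:P + 'X) x%:P.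
have NE v : N.[v] = Psi k (L + x ^+ 2 * v) ((L - x ^+ 3 * v) * (1 - x)) (L + v) x.
  rewrite -[N.[v]]/(horner_eval v N) (Psi_rmorph (horner_eval v)) /= !horner_evalE.
  by rewrite !hornerE.
have [N1 hN] := poly_split0 N.
have N0 : N.[0] = L ^+ (3 * k + 2) * x ^+ (2 * k + 1).
  by rewrite NE !mulr0 addr0 subr0 Psi_V0.
exists N1.[V]; first by rewrite -NE hN hornerD hornerM hornerX hornerC N0.
move=> f fL fx fV.
have fN1 : map_poly f N1 = - (1 + 'X) ^+ k.
  have X0 : 'X != 0 :> {poly F'} by rewrite polyX_eq0.
  apply: (mulfI X0).
  (* At L = 1 and x = 0 the arguments A, B, C become 1, 1, 1 + 'X and b = 0, so [cheb_a0]
     applies. *)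
  have fN : map_poly f N = - ('X * (1 + 'X) ^+ k).
    rewrite (Psi_rmorph (map_poly f)) !(rmorphB, rmorphD, rmorph1, rmorphXn, rmorphM) /=.
    rewrite map_polyX !map_polyC /= fL fx polyC0 polyC1 /Psi mul0r.
    rewrite (cheb_a0 _ k).1 (cheb_a0 _ k).2 !expr0n /= !mul0r addr0 !subr0.
    by rewrite !mul1r !expr1n !mul1r; ring.
  have fN0 : map_poly f (N.[0]%:P) = 0.
    by rewrite map_polyC /= N0 rmorphM !rmorphXn fx addn1 exprS mul0r mulr0 polyC0.
  have := congr1 (map_poly f) hN.
  rewrite fN (rmorphD (map_poly f)) (rmorphM (map_poly f)) -[X in _ = X + _]/(map_poly f N.[0]%:P).
  rewrite fN0 add0r /= map_polyX => <-.
  by rewrite mulrN.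
rewrite -horner_map fN1 fV hornerN horner_exp !hornerE; congr (- _).
by rewrite expr1n.
Qed.

Lemma core_nonneg (R : comNzRingType) (Lv Mv : R) (k : nat) :
  exists P : R, forall f : {rmorphism R -> F},
    (f Mv != 0 -> f P = f Mv ^ shift_exp k * PhiLM k (f Lv) (f Mv)) /\
    (f Lv = 0 -> f P = 1).
Proof.
have [q hq] := Phi_expand_l k (Lv * Mv ^+ (4 * k)) (Mv ^+ 2).
exists (1 + Lv * q) => f; split=> [M0|fL]; last first.
  by rewrite rmorphD rmorph1 rmorphM fL mul0r addr0.
have := congr1 f hq; rewrite Phi_rmorph !(rmorphB, rmorphD, rmorph1, rmorphXn, rmorphM).
move: (f Lv) (f Mv) (f q) M0 => L M fq M0.
have M4 : M ^+ (4 * k) != 0 by rewrite expf_neq0.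
rewrite /PhiLM -PoszM -exprnP -!(exprM M 2) => ->.
rewrite /shift_exp -PoszM -exprnN.
have -> : (2 * (2 * k) = 4 * k)%N by rewrite mulnA.
by field; rewrite M4.
Qed.

(** The case n = -1 stands apart: M^(-4n-6) would be a negative power of M. *)
Lemma core_neg1 (R : comNzRingType) (Lv Mv : R) :
  exists P : R, forall f : {rmorphism R -> F},
    (f Mv != 0 -> f P = f Mv ^ shift_exp (Negz 0) * PhiLM (Negz 0) (f Lv) (f Mv)) /\
    (f Lv = 1 -> f Mv = 0 -> f P = -1).
Proof.
exists (Mv ^+ 2 * (Lv + Mv ^+ 2) ^+ 2 +
        (1 - Mv ^+ 2) * (Mv ^+ 4 - Lv) * (1 + Lv * Mv ^+ 2)) => f.
rewrite !(rmorphB, rmorphD, rmorph1, rmorphXn, rmorphM).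
move: (f Lv) (f Mv) => L M; split=> [M0|-> ->]; last by rewrite !expr0n /=; ring.
rewrite /PhiLM /Phi chebE0 chebOS chebE0 chebO0.
have -> : shift_exp (Negz 0) = 4 by [].
have -> : M ^ (4 * Negz 0) = (M ^+ 4)^-1 by [].
rewrite -[M ^ 4]/(M ^+ 4).
by field; rewrite M0.
Qed.

Lemma core_neg (R : comNzRingType) (Lv Mv : R) (k : nat) :
  exists P : R, forall f : {rmorphism R -> F},
    (f Mv != 0 -> f P = f Mv ^ shift_exp (Negz k.+1) * PhiLM (Negz k.+1) (f Lv) (f Mv)) /\
    (f Lv = 1 -> f Mv = 0 -> f P = -1).
Proof.
have [q hq hf] := Psi_expand_V F k.+1 Lv (Mv ^+ (4 * k + 2)) (Mv ^+ 2).
(* The quotient of [Psi] by V = M^(4k+2), whose constant term in V contributed V M^4 L^D. *)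
exists (Mv ^+ 4 * Lv ^+ hdeg (Negz k.+1) + q) => f; split=> [M0|fL fM]; last first.
  rewrite rmorphD rmorphM rmorphXn fM expr0n mul0r add0r.
  by apply: hf; rewrite // ?rmorphXn fM ?addn2 expr0n.
have := congr1 f hq.
rewrite Psi_rmorph !(rmorphB, rmorphD, rmorph1, rmorphXn, rmorphM).
move: (f Lv) (f Mv) (f q) M0 => L M fq M0.
set v := M ^+ (4 * k + 2) => h.
have v0 : v != 0 by rewrite expf_neq0.
have vM : M ^+ (4 * k.+2) = M ^+ 6 * v.
  by rewrite /v -exprD; congr (_ ^+ _); lia.
apply: (mulfI v0).
transitivity (Psi k.+1 (L + M ^+ 2 ^+ 2 * v) ((L - M ^+ 2 ^+ 3 * v) * (1 - M ^+ 2)) (L + v) (M ^+ 2)).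
  rewrite h /v /hdeg.
  have -> : M ^+ 2 ^+ (2 * k.+1 + 1) = M ^+ (4 * k + 2) * M ^+ 4.
    by rewrite -exprM -exprD; congr (_ ^+ _); lia.
  by ring.
have M3 : M ^+ 2 ^+ (3 * k.+2) != 0 by rewrite !expf_neq0.
apply: (mulfI M3); rewrite -Phi_Psi /PhiLM.
have -> : M ^ (4 * Negz k.+1) = (M ^+ 6 * v)^-1.
  by rewrite -vM NegzE mulrN -PoszM -exprnN.
set A := 1 + _ * M ^+ 2; set B := (_ - 1) * (1 - _); set C := 1 + _ * M ^+ 6.
have c0 : M ^+ 6 * v != 0 by rewrite mulf_neq0 // expf_neq0.
have -> : Phi (Negz k.+1) (M ^+ 2 * (L + M ^+ 2 ^+ 2 * v))
    ((L - M ^+ 2 ^+ 3 * v) * (1 - M ^+ 2)) (M ^+ 2 ^+ 3 * (L + v)) (M ^+ 2) =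
  Phi (Negz k.+1) (M ^+ 6 * v * A) (M ^+ 6 * v * B) (M ^+ 6 * v * C) (M ^+ 2).
  have e (u w : F) : u != 0 -> u * (1 + L / u * w) = u + L * w by move=> u0; field.
  have e' (u w : F) : u != 0 -> u * ((L / u - 1) * w) = (L - u) * w by move=> u0; field.
  by congr (Phi _ _ _ _ _); rewrite /A /B /C ?(e, e') //; ring.
rewrite Phi_scale mulrA mulrA; congr (_ * _).
rewrite -vM /v -!exprM !exprnP -!expfzDr //; congr (_ ^ _).
by rewrite /shift_exp /hdeg !(PoszM, PoszD) !intS; ring.
Qed.

(** The nonzero value at M = 0 excludes the factor M. It is 1 at L = 0 for n >= 0 and -1 at L = 1
    for n < 0. *)
Lemma core_polynomial n :
  exists P : {poly {poly F}},
  (forall L M, M != 0 -> evLM L M P = M ^ shift_exp n * PhiLM n L M) /\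
  (exists L, evLM L 0 P != 0).
Proof.
have evL L M : evLM L M 'X = L by rewrite evLME !hornerE.
have evM L M : evLM L M 'X%:P = M by rewrite evLME !hornerE.
have wrap c l (P : {poly {poly F}}) : c != 0 ->
    (forall L M, (M != 0 -> evLM L M P = M ^ shift_exp n * PhiLM n L M) /\
       (L = l -> M = 0 -> evLM L M P = c)) ->
    exists P : {poly {poly F}},
      (forall L M, M != 0 -> evLM L M P = M ^ shift_exp n * PhiLM n L M) /\
      (exists L, evLM L 0 P != 0).
  move=> c0 hP; exists P; split=> [L M|]; first by case: (hP L M).
  by exists l; rewrite (hP l 0).2.
case: n wrap => [k|[|k]] wrap.
- have [P hP] := core_nonneg ('X : {poly {poly F}}) 'X%:P k.
  apply: (wrap 1 0 P (oner_neq0 _)) => L M; have := hP (evLM L M).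
  by rewrite /= evL evM => -[h1 h2]; split=> // hL _; apply: h2.
- have [P hP] := core_neg1 ('X : {poly {poly F}}) 'X%:P.
  apply: (wrap (-1) 1 P) => [|L M]; first by rewrite oppr_eq0 oner_neq0.
  by have := hP (evLM L M); rewrite /= evL evM.
- have [P hP] := core_neg ('X : {poly {poly F}}) 'X%:P k.
  apply: (wrap (-1) 1 P) => [|L M]; first by rewrite oppr_eq0 oner_neq0.
  by have := hP (evLM L M); rewrite /= evL evM.
Qed.

End CorePolynomial.

(** * Vanishing at generic points *)

Section FormalDegree.
Variable R : comNzRingType.
Implicit Types (p q : {poly R}) (c d x : R).

(* c is the coefficient of degree k, possibly zero, of p of degree at most k. *)
Definition fdeg k p c := (size p <= k.+1)%N /\ p`_k = c.

Lemma fdegC c : fdeg 0 c%:P c.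
Proof. by split; rewrite ?coefC ?size_polyC ?leq_b1. Qed.

Lemma fdegD k p q c d : fdeg k p c -> fdeg k q d -> fdeg k (p + q) (c + d).
Proof.
move=> [sp <-] [sq <-]; split; last by rewrite coefD.
by rewrite (leq_trans (size_polyD _ _)) // geq_max sp.
Qed.

Lemma fdegN k p c : fdeg k p c -> fdeg k (- p) (- c).
Proof. by move=> [sp <-]; split; rewrite ?size_polyN ?coefN. Qed.

Lemma fdegM j k p q c d : fdeg j p c -> fdeg k q d -> fdeg (j + k) (p * q) (c * d).
Proof.
move=> [sp <-] [sq <-]; split.
  by rewrite (leq_trans (size_polyMleq _ _)) // -ltnS; lia.
rewrite coefM (bigD1 (inord j)) //= inordK ?ltnS ?leq_addr // addKn.
rewrite big1 ?addr0 // => i; rewrite -val_eqE /= inordK ?ltnS ?leq_addr // => ij.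
case: (ltngtP i j) ij => // ij _; last by rewrite nth_default ?mul0r // (leq_trans sp).
by rewrite [q`__]nth_default ?mulr0 // (leq_trans sq) //; lia.
Qed.

Lemma fdegX k p c m : fdeg k p c -> fdeg (m * k) (p ^+ m) (c ^+ m).
Proof.
move=> h; elim: m => [|m IH]; first by rewrite mul0n !expr0; apply: fdegC.
by rewrite mulSn !exprS; apply: fdegM.
Qed.

Lemma fdeg_linear c d : fdeg 1 (c%:P + 'X * d%:P) d.
Proof.
split; last by rewrite coefD coefC coefXM coefC add0r.
rewrite (leq_trans (size_polyD _ _)) // geq_max size_polyC (leq_trans (leq_b1 _)) //.
by rewrite (leq_trans (size_polyMleq _ _)) // size_polyX size_polyC; case: (d != 0).
Qed.

Lemma cheb_fdeg a b k a0 b0 : fdeg 3 a a0 -> fdeg 3 b b0 ->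
  fdeg (3 * k) (chebE a b k) (chebE a0 b0 k) /\
  fdeg (3 * k) (chebO a b k.+1) (chebO a0 b0 k.+1).
Proof.
move=> ha hb; elim: k => [|k [IHE IHO]].
  rewrite muln0 !chebOS !chebE0 !chebO0 !mulr0 !add0r.
  by split; apply: fdegC.
have hE : fdeg (3 * k.+1) (chebE a b k.+1) (chebE a0 b0 k.+1).
  by rewrite !(chebES, mulnS); apply: fdegD; apply: fdegM.
split=> //; rewrite (chebOS a) (chebOS a0); apply: fdegD => //.
by rewrite mulnS; apply: fdegM.
Qed.

(** [Phi] is homogeneous in A, B, C, so for linear arguments its top coefficient is [Phi] of their
    top coefficients. *)
Lemma Phi_fdeg n A B C x a b c : fdeg 1 A a -> fdeg 1 B b -> fdeg 1 C c ->
  fdeg (hdeg n) (Phi n A B C x%:P) (Phi n a b c x).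
Proof.
move=> hA hB hC.
have ha : fdeg 3 (B ^+ 2 * C) (b ^+ 2 * c) := fdegM (fdegX 2 hB) hC.
have hb : fdeg 3 (x%:P * A ^+ 3) (x * a ^+ 3) := fdegM (fdegC x) (fdegX 3 hA).
case: n => [[|k]|k]; rewrite /Phi /hdeg.
- by rewrite !chebE0 !chebO0 !mulr0 !addr0; apply: fdegC.
- have [hE _] := cheb_fdeg k.+1 ha hb; have [_ hO] := cheb_fdeg k ha hb.
  apply: fdegD => //; rewrite mulnS; apply: fdegM hO.
  exact: (fdegM (fdegM hB hC) hA).
- have [hE hO] := cheb_fdeg k ha hb; rewrite addnC.
  apply: fdegD; first exact: (fdegM (fdegM (fdegC x) (fdegX 2 hA)) hE).
  by apply: fdegN; exact: (fdegM (fdegM hB hC) hO).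
Qed.

Lemma fdeg_size k p c : fdeg k p c -> c != 0 -> size p = k.+1 /\ lead_coef p = c.
Proof.
move=> [sp <-] c0; have e : size p = k.+1.
  by apply/eqP; rewrite eqn_leq sp; rewrite ltnNge; apply: contraNN c0 => h; rewrite nth_default.
by rewrite /lead_coef e.
Qed.

End FormalDegree.

Section GenericPoints.
Variable F : numClosedFieldType.
Implicit Types (p q g : {poly F}) (P Q f : {poly {poly F}}).

Lemma poly_nonroot p : p != 0 -> exists x, p.[x] != 0.
Proof.
move=> p0; pose rs : seq F := [seq i%:R | i <- iota 0 (size p)].
have [/allP h|/allPn [x _ hx]] := boolP (all (root p) rs); last by exists x.
have us : uniq rs by rewrite map_inj_uniq ?iota_uniq // => i j /eqP; rewrite eqr_nat => /eqP.
have /allP hr := h; have := max_poly_roots p0 hr us.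
by rewrite size_map size_iota ltnn.
Qed.

Lemma poly_eq0_generic g p : g != 0 -> (forall x, g.[x] != 0 -> p.[x] = 0) -> p = 0.
Proof.
move=> g0 h; apply/eqP; apply: contraT => p0.
have [x] := poly_nonroot (mulf_neq0 p0 g0); rewrite hornerM mulf_eq0 negb_or => /andP [px gx].
by rewrite h ?eqxx in px.
Qed.

Lemma poly_ext p q : (forall x, p.[x] = q.[x]) -> p = q.
Proof.
move=> h; apply: subr0_eq; apply: (poly_eq0_generic (oner_neq0 _)) => x _.
by rewrite hornerD hornerN h subrr.
Qed.

Lemma slice_eq0_generic g P : g != 0 -> (forall M, g.[M] != 0 -> slice M P = 0) -> P = 0.
Proof.
move=> g0 h; apply/polyP => i; rewrite coef0; apply: (poly_eq0_generic g0) => M /h e.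
by have := congr1 (fun p : {poly F} => p`_i) e; rewrite coef0 coef_map.
Qed.

Lemma double_root_factor p v : root p v -> root p^`() v ->
  exists q, p = ('X - v%:P) ^+ 2 * q.
Proof.
case/factor_theorem => q ->; rewrite derivM derivXsubC mulr1 /root hornerD hornerM.
rewrite hornerXsubC subrr mulr0 add0r => /factor_theorem [q' ->].
by exists q'; ring.
Qed.

(** The Nullstellensatz in one variable: p splits into linear factors, each of which divides q. *)
Lemma dvdp_exp_roots p q : p != 0 -> (forall x, root p x -> root q x) ->
  p %| q ^+ size p.
Proof.
move=> p0 h; have [r e] := closed_field_poly_normal p.
have hr x : x \in r -> root q x.
  by move=> xr; apply: h; rewrite e rootZ ?lead_coef_eq0 // root_prod_XsubC.
have sz : size p = (size r).+1.
  by rewrite e size_scale ?lead_coef_eq0 // size_prod_XsubC.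
rewrite sz exprS dvdp_mull // e dvdpZl ?lead_coef_eq0 //.
elim: r hr {e sz} => [|x r IH] hr; first by rewrite big_nil expr0 dvdpp.
rewrite big_cons exprS dvdp_mul // ?dvdp_XsubCl ?hr ?mem_head //.
by apply: IH => y yr; apply: hr; rewrite inE yr orbT.
Qed.

(* Dividing f^d by P and specializing M generically kills the remainder. *)
Lemma vanishing_extends g P f : g != 0 ->
  (forall M, M != 0 -> (lead_coef P).[M] != 0) ->
  (forall L M, M != 0 -> g.[M] != 0 -> evLM L M P = 0 -> evLM L M f = 0) ->
  forall L M, M != 0 -> evLM L M P = 0 -> evLM L M f = 0.
Proof.
move=> g0 lcP hf L0 M0 M00 hP.
have P0 : P != 0.
  by apply: contraTneq (lcP 1 (oner_neq0 _)) => ->; rewrite lead_coef0 horner0 eqxx.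
have := Pdiv.Idomain.divp_eq (f ^+ size P) P.
set k := Pdiv.Idomain.scalp _ _; set q := Pdiv.Idomain.divp _ _.
set r := Pdiv.Idomain.modp _ _ => hdiv.
have sr : (size r < size P)%N by rewrite Pdiv.Idomain.ltn_modp.
(* On a generic slice P keeps its degree and divides f^d, hence the remainder, whose degree is
   smaller; so the remainder vanishes there. *)
have r0 : r = 0.
  have g1 : 'X * g != 0 by rewrite mulf_neq0 // polyX_eq0.
  apply: (slice_eq0_generic g1) => M.
  rewrite hornerM hornerX mulf_eq0 negb_or => /andP [MM gM].
  have sP : size (slice M P) = size P by rewrite size_map_poly_id0 // lcP.
  have PM0 : slice M P != 0 by rewrite -size_poly_eq0 sP size_poly_eq0.
  have hd : slice M P %| slice M f ^+ size P.
    rewrite -sP; apply: dvdp_exp_roots => // x /rootP h.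
    by apply/rootP; rewrite -evLM_slice; apply: hf; rewrite // evLM_slice.
  have hr : slice M P %| slice M r.
    have -> : r = lead_coef P ^+ k *: f ^+ size P - q * P by rewrite hdiv addrC addKr.
    rewrite -mul_polyC /slice rmorphB !rmorphM /=.
    rewrite [map_poly _ (f ^+ _)](rmorphXn (map_poly (horner_eval M))) /=.
    by rewrite dvdp_sub ?dvdp_mull.
  apply/eqP; apply: contraT => rM0; have := dvdp_leq rM0 hr; rewrite sP leqNgt.
  by rewrite (leq_ltn_trans _ sr) // size_poly.
have := congr1 (evLM L0 M0) hdiv; rewrite r0 addr0 rmorphM /= hP mulr0.
rewrite -mul_polyC rmorphM /= [evLM _ _ (f ^+ _)](rmorphXn (evLM L0 M0)) /= => /eqP; rewrite mulf_eq0 expf_eq0 => /orP [|].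
  rewrite evLME hornerC horner_exp => /eqP h.
  by have := expf_neq0 k (lcP _ M00); rewrite h eqxx.
by case/andP => _ /eqP.
Qed.

End GenericPoints.

(** * Squarefreeness *)

(* Phi at l = 1 + e v, x = e - 1, divided by e^D. *)
Definition blowup (R : comNzRingType) n (e : R) : {poly R} :=
  Phi n (1%:P + 'X * (e - 1)%:P) (0%:P + 'X * (2 - e)%:P)
    ((3 - 3 * e + e ^+ 2)%:P + 'X * ((e - 1) ^+ 3)%:P) (e - 1)%:P.

Lemma blowup_morph (R S : comNzRingType) (f : {rmorphism R -> S}) n (e : R) :
  map_poly f (blowup n e) = blowup n (f e).
Proof.
rewrite /blowup (Phi_rmorph (map_poly f)) !(rmorphD (map_poly f)) !(rmorphM (map_poly f)) /=.
by rewrite map_polyX !map_polyC /= !(rmorphB, rmorphD, rmorph1, rmorph0, rmorphXn, rmorphM, rmorph_nat).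
Qed.

Lemma blowup_fdeg (R : comNzRingType) n (e : R) :
  fdeg (hdeg n) (blowup n e) (Phi n (e - 1) (2 - e) ((e - 1) ^+ 3) (e - 1)).
Proof. by apply: Phi_fdeg; apply: fdeg_linear. Qed.

Lemma horner_blowup (R : comNzRingType) n (e v : R) :
  e ^+ hdeg n * (blowup n e).[v] =
  Phi n (1 + (1 + e * v) * (e - 1)) ((1 + e * v - 1) * (1 - (e - 1)))
    (1 + (1 + e * v) * (e - 1) ^+ 3) (e - 1).
Proof.
rewrite -[_.[v]]/(horner_eval v (blowup n e)) /blowup (Phi_rmorph (horner_eval v)).
rewrite /= !horner_evalE !(hornerD, hornerM, hornerC, hornerX) -Phi_scale.
by congr (Phi _ _ _ _ _); ring.
Qed.

(** * Separability at M^2 = -1 *)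

Section Separability.
Variable F : numClosedFieldType.
Variable n : int.
Let D := hdeg n.
Let Phi0 (v : F) := Phi n (1 - v) (2 * v) (3 - v) (-1).
Let p0 : {poly F} := Phi n (1%:P + 'X * (-1)%:P) (0%:P + 'X * 2%:P) (3%:P + 'X * (-1)%:P) (-1)%:P.

Let p0E v : p0.[v] = Phi0 v.
Proof.
rewrite -[p0.[v]]/(horner_eval v p0) (Phi_rmorph (horner_eval v)) /= !horner_evalE.
by rewrite !hornerE /Phi0; congr (Phi _ _ _ _ _); ring.
Qed.

Let lead0 : Phi n (-1) 2 (-1) (-1) != 0 :> F.
Proof. by rewrite Phi_m1_lead signr_eq0. Qed.

Let p0_size : size p0 = D.+1.
Proof.
have h := Phi_fdeg n (-1) (fdeg_linear 1 (-1)) (fdeg_linear 0 2) (fdeg_linear 3 (-1 : F)).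
by have [] := fdeg_size h lead0.
Qed.

Let r (q : F) := q ^+ 2 - q + 1.
Let s (q : F) := q ^+ 2 + q + 1.

(** With v = s(q) / r(q) the triple (1 - v, 2v, 3 - v) is 2 / r(q) times the arguments (-q, q^2 + q
    + 1, (q - 1)^2) of [Phi_dihedral]. *)
Let p0_dihedral q : r q != 0 ->
  (1 + q) * (r q ^+ D * p0.[s q / r q]) =
  2 ^+ D * (if n is Posz _ then 1 else -1) * (1 + q ^+ (2 * D + 1)).
Proof.
move=> rq; rewrite p0E /Phi0 -Phi_scale.
have -> : Phi n (r q * (1 - s q / r q)) (r q * (2 * (s q / r q)))
    (r q * (3 - s q / r q)) (-1) =
  Phi n (2 * (- q)) (2 * (q ^+ 2 + q + 1)) (2 * (q - 1) ^+ 2) (-1).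
  have e a b : r q * (a - b * (s q / r q)) = a * r q - b * s q by field.
  congr (Phi _ _ _ _ _).
  - by rewrite -[s q / r q]mul1r e /r /s; ring.
  - by rewrite mulrCA (mulrCA (r q)) mulfV // mulr1.
  - by rewrite -[s q / r q]mul1r e /r /s; ring.
rewrite Phi_scale; have h := Phi_dihedral n q.
have rq' : 1 - q + q ^+ 2 != 0 by rewrite (_ : _ + _ = r q) // /r; ring.
by rewrite mulrCA (mulfI rq' h) mulrA.
Qed.

(** A double root v would pull back along q -> s(q) / r(q) to a double root of 1 + q^(2D+1), which
    has none in characteristic 0. *)
Lemma p0_separable v : root p0 v -> ~~ root p0^`() v.
Proof.
move=> rv; apply/negP => rv'; have [p1 e1] := double_root_factor rv rv'.
have p1n0 : p1 != 0.
  by apply: contraTneq isT => h; have := p0_size; rewrite e1 h mulr0 size_poly0.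
have sz : (size p1).-1.+2 = D.
  apply/eqP; rewrite -eqSS -p0_size e1 mulrC size_Mmonic ?monicXn //.
    by rewrite size_exp_XsubC addnC /= prednK // lt0n size_poly_eq0.
  by rewrite monic_exp // monicXsubC.
set e := (size p1).-1 in sz.
pose rp : {poly F} := 'X^2 - 'X + 1; pose sp : {poly F} := 'X^2 + 'X + 1.
have rpE q : rp.[q] = r q by rewrite !hornerE.
have spE q : sp.[q] = s q by rewrite !hornerE.
pose t := sp - v%:P * rp.
(* The polynomial p1(s / r) with its denominators r^e cleared. *)
pose h1 := \sum_(i < e.+1) p1`_i *: (sp ^+ i * rp ^+ (e - i)).
have h1E q : r q != 0 -> h1.[q] = r q ^+ e * p1.[s q / r q].
  move=> rq; rewrite (@horner_coef_wide _ e.+1 _ _ (leqSpred _)).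
  rewrite horner_sum mulr_sumr; apply: eq_bigr => i _.
  rewrite hornerZ hornerM !horner_exp rpE spE [RHS]mulrCA; congr (_ * _).
  rewrite expr_div_n [RHS]mulrCA; congr (_ * _).
  rewrite -[X in _ = _ ^+ X / _](subnK (ltn_ord i : (i <= e)%N)) exprD mulfK //.
  by rewrite expf_neq0.
pose c : F := 2 ^+ D * (if n is Posz _ then 1 else -1).
have c0 : c != 0.
  rewrite mulf_neq0 ?expf_neq0 ?pnatr_eq0 //.
  by case: (n) => _; rewrite ?oppr_eq0 oner_neq0.
have key : (1 + 'X) * (t ^+ 2 * h1) = c *: (1 + 'X^(2 * D + 1)).
  have rp0 : rp != 0.
    by apply: contraTneq isT => h; have := rpE 0; rewrite h horner0 /r => /eqP; rewrite expr0n /= subrr add0r eq_sym oner_eq0.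
  apply: subr0_eq; apply: (poly_eq0_generic rp0) => q; rewrite rpE => rq.
  have := p0_dihedral rq; rewrite e1 => hd.
  rewrite hornerD hornerN hornerZ hornerD hornerXn hornerC /c -hd.
  rewrite !hornerM hornerD hornerX hornerC ?horner_exp hornerXsubC h1E // -sz.
  rewrite /t hornerD hornerN hornerM hornerC spE rpE !exprS.
  by apply/eqP; rewrite subr_eq0; apply/eqP; field.
(* A root exists because the coefficients 1 + v and 1 - v of t add up to 2 and cannot both
   vanish. *)
have [q0 rq0] : exists q0, root t q0.
  apply/closed_rootP/negP => /eqP st.
  have t1 : t`_1 = 1 + v.
    by rewrite /t /sp /rp coefB coefCM !(coefD, coefN, coefXn, coefX, coef1) /=; ring.
  have t2 : t`_2 = 1 - v.
    by rewrite /t /sp /rp coefB coefCM !(coefD, coefN, coefXn, coefX, coef1) /=; ring.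
  rewrite nth_default ?st // in t1; rewrite nth_default ?st // in t2.
  have : (2%:R : F) = 0 by transitivity ((1 + v) + (1 - v)); [ring | rewrite -t1 -t2 addr0].
  by move/eqP; rewrite pnatr_eq0.
have tq0 : t.[q0] = 0 by apply/rootP.
have k1 := congr1 (fun p => p.[q0]) key.
have k2 := congr1 (fun p => p^`().[q0]) key.
(* The derivative of [key] at q0 forces this; then 1 + q0^(2D+1) = 1 contradicts [key] itself. *)
have q00 : q0 ^+ (2 * D) = 0.
  apply: (mulfI c0); rewrite mulr0.
  have d0 : (2 * D + 1)%:R != 0 :> F by rewrite pnatr_eq0 addn1.
  apply: (mulfI d0); rewrite mulr0.
  have dR : (c *: (1 + 'X^(2 * D + 1)))^`().[q0] = (2 * D + 1)%:R * (c * q0 ^+ (2 * D)).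
    rewrite derivZ derivD -polyC1 derivC add0r derivXn addn1 /=.
    by rewrite hornerZ hornerMn hornerXn -mulr_natl mulrCA.
  rewrite -dR -k2 (exprS t) mulrCA -mulrA derivM.
  by rewrite hornerD !hornerM tq0 !(mul0r, mulr0) addr0.
move: k1; rewrite /= !hornerM tq0 !(mul0r, mulr0) hornerZ hornerD -polyC1 hornerC.
rewrite hornerXn exprD q00 mul0r addr0 mulr1 => /esym /eqP.
by rewrite (negPf c0).
Qed.

End Separability.

Section Squarefree.
Variable F : numClosedFieldType.
Implicit Types (n : int) (L M : F).

Lemma blowup0_separable n (v : F) :
  root (blowup n 0) v -> ~~ root (blowup n 0 : {poly F})^`() v.
Proof.
have -> : blowup n (0 : F) = Phi n (1%:P + 'X * (-1)%:P) (0%:P + 'X * 2%:P)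
    (3%:P + 'X * (-1)%:P) (-1)%:P.
  by rewrite /blowup; congr (Phi _ (_ + _ * _%:P) (_ + _ * _%:P) (_%:P + _ * _%:P) _%:P); ring.
exact: p0_separable.
Qed.

Lemma size_blowup0 n : size (blowup n 0 : {poly F}) = (hdeg n).+1.
Proof.
have h := blowup_fdeg n (0 : F); have [] // := fdeg_size h.
have -> : (0 - 1) ^+ 3 = -1 :> F by ring.
by rewrite sub0r subr0 Phi_m1_lead signr_eq0.
Qed.

Lemma hdeg_gt1 n : (1 < hdeg n)%N || (n == Posz 0).
Proof. by case: n => [[|k]|k]; rewrite /hdeg ?orbT // ?mulnS // addn2. Qed.

Lemma size_deriv_char0 (p : {poly F}) : size p^`() = (size p).-1.
Proof.
have [->|p0] := eqVneq p 0; first by rewrite deriv0 size_poly0.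
case e: (size p) => [|[|k]] /=.
- by move/eqP: e; rewrite size_poly_eq0 (negPf p0).
- by have /eqP/size_poly1P [c _ ->] := e; rewrite derivC size_poly0.
apply/eqP; rewrite eqn_leq; apply/andP; split.
  by have := lt_size_deriv p0; rewrite e ltnS.
rewrite ltnNge.
apply/negP => h; have := coef_deriv p k; rewrite nth_default // => /esym /eqP.
rewrite mulrn_eq0 /= => /eqP pk; have : lead_coef p != 0 by rewrite lead_coef_eq0.
by rewrite /lead_coef e /= pk eqxx.
Qed.

(** The witness g is the resultant in v of the family and its derivative, nonzero because it is
    nonzero at e = 0. The case n = 0 is constant and separate, as the resultant argument needs
    degree at least 2. *)
Lemma blowup_separable n : exists2 g : {poly F}, g != 0 &
  forall e v, g.[e] != 0 -> root (blowup n e) v -> ~~ root (blowup n e)^`() v.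
Proof.
case/orP: (hdeg_gt1 n) => [D1|/eqP ->]; last first.
  exists 1 => [|e v _]; first exact: oner_neq0.
  by rewrite /blowup /Phi chebE0 chebO0 mulr0 addr0 rootE -polyC1 hornerC oner_eq0.
pose p : {poly {poly F}} := blowup n 'X.
have ps e : slice e p = blowup n e.
  by rewrite /slice blowup_morph /= horner_evalE hornerX.
have sp : size p = (hdeg n).+1.
  apply/eqP; rewrite eqn_leq (blowup_fdeg n _).1 -(size_blowup0 n) -ps.
  exact: size_poly.
(* The degrees of p and p' do not drop at e = 0, so the resultant commutes with this
   specialization. *)
have lp : horner_eval 0 (lead_coef p) != 0.
  rewrite /lead_coef sp /= -coef_map -/(slice 0 p) ps.
  have := size_blowup0 n; have : blowup n 0 != 0 :> {poly F} by rewrite -size_poly_eq0 size_blowup0.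
  by rewrite -lead_coef_eq0 /lead_coef => h e; rewrite e in h.
have sp' : size p^`() = hdeg n.
  apply/eqP; rewrite eqn_leq -ltnS -sp lt_size_deriv -?size_poly_eq0 ?sp //=.
  have -> : hdeg n = size (slice 0 p)^`() by rewrite ps size_deriv_char0 size_blowup0.
  by rewrite /slice deriv_map size_poly.
have lp' : horner_eval 0 (lead_coef p^`()) != 0.
  have lpE : lead_coef p = p`_(hdeg n) by rewrite /lead_coef sp.
  rewrite /lead_coef sp' coef_deriv prednK ?(ltnW D1) // -lpE rmorphMn mulrn_eq0 negb_or lp andbT.
  by rewrite -lt0n (ltnW D1).
exists (resultant p p^`()) => [|e v].
  apply: contraNneq (oner_neq0 F) => r0.
  have := map_resultant lp lp'; rewrite r0 rmorph0 -deriv_map -/(slice 0 p) ps => /esym /eqP.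
  rewrite resultant_eq0 => h.
  have : coprimep (blowup n 0) (blowup n 0 : {poly F})^`().
    apply/Pdiv.ClosedField.coprimepP => x /blowup0_separable.
    by rewrite /root.
  by rewrite /coprimep => /eqP hs; rewrite hs in h.
have s1 : (1 < size p)%N by rewrite sp ltnS ltnW.
have s2 : (1 < size p^`())%N by rewrite sp'.
have [[u w] _ /= hr] := resultant_in_ideal s1 s2.
move=> ge /rootP hv; apply: contraNN ge => /rootP hv'.
have := congr1 (evLM v e) hr; rewrite rmorphD !rmorphM /= !evLM_slice.
by rewrite /slice -deriv_map -/(slice e p) ps hv hv' !mulr0 addr0 map_polyC hornerC => h; apply/eqP.
Qed.

Variables (n : int) (P : {poly {poly F}}).
Hypothesis PE : forall L M, M != 0 -> evLM L M P = M ^ shift_exp n * PhiLM n L M.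

Lemma core_at0 M : M != 0 -> evLM 0 M P != 0.
Proof.
move=> M0; rewrite PE // /PhiLM mul0r !mul0r !addr0 sub0r mulN1r mulf_neq0 ?expfz_neq0 //.
by rewrite Phi_at_l0; case: (n) => k; rewrite ?oner_neq0 ?expf_neq0.
Qed.

(** By [Phi_lead] every slice at M != 0 has the full degree [hdeg n], which is therefore the degree
    of P in L. *)
Lemma core_lead : forall M, M != 0 -> (lead_coef P).[M] != 0.
Proof.
have hs M : M != 0 -> size (slice M P) = (hdeg n).+1.
  move=> M0; pose m := M ^ (4 * n); pose x := M ^+ 2.
  have m0 : m != 0 by rewrite expfz_neq0.
  pose p := Phi n (1%:P + 'X * (m * x)%:P) ((- (1 - x))%:P + 'X * (m * (1 - x))%:P)
    (1%:P + 'X * (m * x ^+ 3)%:P) x%:P.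
  have fp : fdeg (hdeg n) p _ := Phi_fdeg n x (fdeg_linear _ _) (fdeg_linear _ _) (fdeg_linear _ _).
  rewrite Phi_scale Phi_lead in fp.
  have c0 : m ^+ hdeg n * (if n is Posz k then x ^+ (3 * k) else x ^+ (5 * `|n| - 1)) != 0.
    by rewrite mulf_neq0 ?expf_neq0 //; case: (n) => k; rewrite !expf_neq0.
  have [sp _] := fdeg_size fp c0.
  have -> : slice M P = M ^ shift_exp n *: p.
    apply: poly_ext => L; rewrite -evLM_slice PE // hornerZ; congr (_ * _).
    rewrite -[p.[L]]/(horner_eval L p) (Phi_rmorph (horner_eval L)) /= !horner_evalE.
    rewrite !(hornerD, hornerM, hornerC, hornerX) /PhiLM -/m /x.
    by congr (Phi _ _ _ _ _); ring.
  by rewrite size_scale ?expfz_neq0.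
have sP : size P = (hdeg n).+1.
  apply/eqP; rewrite eqn_leq; apply/andP; split; last first.
    by rewrite -(hs 1 (oner_neq0 _)) size_poly.
  apply/leq_sizeP => j hj; apply: (@poly_eq0_generic _ 'X); first by rewrite polyX_eq0.
  move=> M; rewrite hornerX => /hs sM; rewrite -[_.[M]]/(horner_eval M _) -coef_map.
  by rewrite -/(slice M P) nth_default // sM.
move=> M /hs sM; rewrite /lead_coef sP -[_.[M]]/(horner_eval M _) -coef_map -/(slice M P).
have : slice M P != 0 by rewrite -size_poly_eq0 sM.
by rewrite -lead_coef_eq0 /lead_coef sM.
Qed.

Hypothesis P_M0 : exists L, evLM L 0 P != 0.

(** For e = M^2 + 1 nonzero, v = (l - 1) / e is an affine function of L, and it turns the slice into
    a scalar multiple of [blowup n e]. *)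
Lemma core_slice_separable : exists2 g : {poly F}, g != 0 &
  forall L M, M != 0 -> g.[M] != 0 -> root (slice M P) L -> ~~ root (slice M P)^`() L.
Proof.
have [g g0 hg] := blowup_separable n.
have s2 : size ('X^2 + 1 : {poly F}) = 3 by rewrite size_XnaddC.
have X21 : 'X^2 + 1 != 0 :> {poly F} by rewrite -size_poly_eq0 s2.
exists (('X^2 + 1) * (g \Po ('X^2 + 1))).
  by rewrite mulf_neq0 // comp_poly_eq0 ?s2.
move=> L M M0; rewrite hornerM horner_comp hornerD hornerXn -polyC1 hornerC mulf_eq0 negb_or.
set e := M ^+ 2 + 1 => /andP [e0 ge]; set m := M ^ (4 * n).
have m0 : m != 0 by rewrite expfz_neq0.
have c0 : M ^ shift_exp n * e ^+ hdeg n != 0 by rewrite mulf_neq0 ?expf_neq0 ?expfz_neq0.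
have -> : slice M P = (M ^ shift_exp n * e ^+ hdeg n) *:
    (blowup n e \Po ((m / e) *: 'X - (e^-1)%:P)).
  apply: poly_ext => l; rewrite -evLM_slice PE // hornerZ -mulrA horner_comp horner_blowup.
  congr (_ * _); rewrite hornerD hornerN hornerZ hornerX hornerC /PhiLM -/m.
  have -> : e - 1 = M ^+ 2 by rewrite /e addrK.
  have -> : 1 + e * (m / e * l - e^-1) = l * m by field.
  by congr (Phi _ _ _ _ _); rewrite -exprM.
rewrite derivZ deriv_comp derivB derivC derivZ derivX subr0 !rootZ // /root hornerM !horner_comp hornerZ -polyC1 hornerC mulr1.
move=> h; rewrite mulf_neq0 // ?mulf_neq0 ?invr_eq0 //; exact: hg h.
Qed.

(** If Q involves L, a root of its generic slice is a double root of the slice of P. If Q depends on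
    M only, a root of it would make P vanish on a whole line, contrary to [core_at0] or, at M = 0,
    to [P_M0]. *)
Lemma core_squarefree (Q R : {poly {poly F}}) : P = Q * Q * R -> Q \is a GRing.unit.
Proof.
move=> eP; have hQ L M : evLM L M Q = 0 -> evLM L M P = 0.
  by rewrite eP !rmorphM /= => ->; rewrite !mul0r.
have [g g0 hg] := core_slice_separable.
have Q0 : Q != 0.
  apply: contraTneq (core_at0 (oner_neq0 _)) => h.
  by rewrite negbK; apply/eqP/hQ; rewrite h rmorph0.
have sQ : (size Q <= 1)%N.
  rewrite leqNgt; apply/negP => s1.
  have h0 : 'X * g * lead_coef Q != 0 by rewrite !mulf_neq0 ?polyX_eq0 ?lead_coef_eq0.
  have [M] := poly_nonroot h0; rewrite !hornerM hornerX !mulf_eq0 !negb_or.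
  case/andP => /andP [M0 gM] lM.
  have sM : size (slice M Q) = size Q by rewrite size_map_poly_id0.
  have [L rL] : exists L, root (slice M Q) L.
    by apply/closed_rootP; rewrite sM neq_ltn s1 orbT.
  have PM : slice M P = slice M Q * (slice M Q * slice M R).
    by rewrite eP /slice -!rmorphM mulrA.
  have rP : root (slice M P) L by rewrite PM rootM rL.
  have := hg L M M0 gM rP; rewrite PM derivM rootE hornerD !hornerM.
  by rewrite (rootP rL) !(mul0r, mulr0) addr0 eqxx.
have [q eQ] : exists q, Q = q%:P by exists Q`_0; apply: size1_polyC.
have q0 : q != 0 by apply: contraNneq Q0 => h; rewrite eQ h.
have sq : size q = 1.
  apply/eqP; apply: contraT => /closed_rootP [M /rootP hM].
  have hP L : evLM L M P = 0 by apply: hQ; rewrite evLME eQ hornerC.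
  have [MM|M0] := eqVneq M 0.
    by case: P_M0 => L; have := hP L; rewrite MM => ->; rewrite eqxx.
  by have := core_at0 M0; rewrite hP eqxx.
rewrite eQ poly_unitE size_polyC q0 coefC /= poly_unitE sq /= unitfE.
by have := q0; rewrite -lead_coef_eq0 /lead_coef sq.
Qed.

End Squarefree.

(** * The A-polynomial *)

Section MainOverField.
Variables (F : numClosedFieldType) (n : int).

Let E (L M : F) := L != 0 /\ M != 0 /\ eigen_over n L M.
Let ev (P : {poly {poly F}}) (L M : F) : F := P.[M%:P].[L].

Lemma A_polynomial_over : exists P : {poly {poly F}},
  [/\ P != 0, forall Q R, P = Q * Q * R -> Q \is a GRing.unit,
      (forall R, P <> 'X * R) /\ (forall R, P <> 'X%:P * R),
      forall L M : F,
        (L != 0 /\ M != 0 /\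
         forall f, (forall L' M', E L' M' -> ev f L' M' = 0) -> ev f L M = 0) <->
        (L != 0 /\ M != 0 /\ ev P L M = 0)
    & forall L M : F, M != 0 -> ev P L M = M ^ shift_exp n * PhiLM n L M].
Proof.
have evE f L M : ev f L M = evLM L M (swapXY f) by rewrite /ev evLME horner2_swapXY.
have [P [PE PM0]] := core_polynomial F n.
have evP L M : ev (swapXY P) L M = evLM L M P by rewrite evE swapXYK.
have E_zero L M : E L M -> evLM L M P = 0.
  by case=> _ [M0 h]; rewrite PE // /PhiLM (eigen_over_Phi M0 h) mulr0.
have P10 := core_at0 PE (oner_neq0 F).
exists (swapXY P); split.
- by rewrite swapXY_eq0; apply: contraNneq P10 => ->; rewrite rmorph0.
- move=> Q R h; have h' : P = swapXY Q * swapXY Q * swapXY R.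
    by rewrite -[LHS]swapXYK h (rmorphM swapXY) (rmorphM swapXY).
  have u := core_squarefree PE PM0 h'.
  apply/unitrPr; exists (swapXY (swapXY Q)^-1).
  by rewrite -{1}(swapXYK Q) -(rmorphM swapXY) mulrV // (rmorph1 swapXY).
- split=> R h.
    by case: PM0 => L; rewrite -evP h /ev hornerM hornerX hornerM hornerC mul0r eqxx.
  by move: P10; rewrite -evP h /ev hornerM hornerC hornerM hornerX mul0r eqxx.
- move=> L M; split=> [[L0 [M0 hcl]]|[L0 [M0 hP]]]; split=> //; split=> //.
    by apply: hcl => L' M' /E_zero; rewrite evP.
  move=> f hf; rewrite evE; rewrite evP in hP.
  (* The slices M^4 = 1, where representations are not constructed, are recovered by
     [vanishing_extends]. *)
  have g0 : ('X^4 - 1 : {poly F}) != 0 by rewrite -size_poly_eq0 size_XnsubC.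
  apply: (vanishing_extends g0 (core_lead PE) _ M0 hP) => L' M' M'0.
  rewrite hornerD hornerN hornerXn -polyC1 hornerC subr_eq0 => M4 hP'.
  rewrite -evE; apply: hf; split; last split=> //.
    by apply: contraNneq (core_at0 PE M'0) => h; rewrite h in hP'; apply/eqP.
  apply: (Phi_eigen_over M'0 M4).
  have := hP'; rewrite PE // => /eqP.
  by rewrite mulf_eq0 (negPf (expfz_neq0 _ M'0)) => /eqP.
- by move=> L M M0; rewrite evP PE.
Qed.

End MainOverField.

(* The A-polynomial of T_{2n} = C(2n,3) is the polynomial given by the
   explicit formula (which is a polynomial: it agrees with one wherever its
   denominators do not vanish). *)
Theorem theorem1 (n : int) :
  exists P : {poly {poly CC}},
    is_A_polynomial n P /\
    (forall L M : CC, formula_defined n L M -> ev2 P L M = A_formula n L M).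
Proof.
have [P [P0 sqP noP clP evP]] := A_polynomial_over CC n.
exists P; split; last first.
  move=> L M hd; rewrite (A_formula_Phi hd); apply: evP.
  by case: hd => _ [].
split; first exact: P0.
split; first exact: sqP.
split; first exact: noP.
(* The closure has no isolated points, so the exceptional set is empty. *)
exists [::] => L M; have [h1 h2] := clP L M; split.
  by move=> h; left; apply: h1.
by case=> // h; apply: h2.
Qed.
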